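(* There exists a regular local ring $(R,\mathfrak{m}_R)$ of dimension $2$ and a discrete, rank $1$ valuation $\nu$ of the quotient field of $R$ dominating $R$, such that each of the functions $n\mapsto\ell_R(R/I_n)$ and $n\mapsto\ell_R(I_n/I_{n+1})$ is not a quasi-polynomial plus a bounded function for large integers $n$, and such that the limits $$\lim_{n \rightarrow \infty} \frac{\ell_R(I_n/I_{n+1})}{n}\quad\text{and}\quad\lim_{n \rightarrow \infty} \frac{\ell_R(R/I_{n})}{n^2}$$ exist and are both irrational (even transcendental) positive numbers.
   Context: A valuation $\nu$ of the quotient field $K$ of $R$ has valuation ring $V_{\nu}=\{f\in K\mid \nu(f)\ge 0\}$ with maximal ideal $\mathfrak{m}_{\nu}=\{f\in K\mid \nu(f)>0\}$; it dominates $R$ if $R\subset V_{\nu}$ and $R\cap\mathfrak{m}_{\nu}=\mathfrak{m}_R$. It is discrete (of rank 1) if its value group is order isomorphic to $\mathbb{Z}$, and the value group is then identified with $\mathbb{Z}$. For $n\in\mathbb{Z}_{\ge 0}$, $I_n=\{f\in R\mid \nu(f)\ge n\}$. $\ell_R$ denotes length as an $R$-module. A quasi-polynomial in $n$ is an expression $a_d(n)n^d+a_{d-1}(n)n^{d-1}+\dots+a_1(n)n+a_0(n)$ whose coefficients $a_0(n),\dots,a_d(n)$ are (real-valued) periodic functions of the integer $n$, with integral period. A function $f$ is ''a quasi-polynomial plus a bounded function for large integers $n$'' if there are a quasi-polynomial $Q(n)$, a bounded function $\sigma(n)$ and an integer $n_0$ with $f(n)=Q(n)+\sigma(n)$ for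 all integers $n\ge n_0$. *)

(* Defs.v *)
From HB Require Import structures.
From mathcomp Require Import all_boot all_order all_algebra.
From mathcomp Require Import generic_quotient ring_quotient.
From mathcomp Require Import all_classical all_reals all_analysis.

Set Implicit Arguments.
Unset Strict Implicit.
Unset Printing Implicit Defensive.

Import Order.TTheory GRing.Theory Num.Theory.
Local Open Scope ring_scope.

(* Subsets are boolean predicates [{pred T}]; under the classical axioms of
   mathcomp.classical every subset is of this form. *)

(* [S 0 < S 1 < ... < S l], strict inclusions among subsets satisfying [C];
   the values of [S] beyond [l] are irrelevant. *)
Definition strict_chain (T : Type) (C : {pred T} -> Prop) (l : nat) : Prop :=
  exists S : nat -> {pred T},
    (forall i, (i <= l)%N -> C (S i)) /\
    (forall i, (i < l)%N ->
       {subset S i <= S i.+1} /\ ~ {subset S i.+1 <= S i}).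

Definition max_chain_length (T : Type) (C : {pred T} -> Prop) (l : nat) : Prop :=
  strict_chain C l /\ forall k, strict_chain C k -> (k <= l)%N.

Definition has_length (R : pzRingType) (M : lmodType R) (l : nat) : Prop :=
  max_chain_length (fun S : {pred M} => GRing.submod_closed S) l.

Section Submodule.
Variables (R : pzRingType) (M : lmodType R) (N : submodClosed M).

Definition submodule : Type := {x : M | x \in N}.

HB.instance Definition _ := SubChoice.on submodule.
HB.instance Definition _ := [SubChoice_isSubLmodule of submodule by <:].
End Submodule.

Section QuotientModule.
Variables (R : pzRingType) (M : lmodType R) (N : submodClosed M).
Local Open Scope quotient_scope.

(* [submodClosed M] does not inherit from [zmodClosed M]. *)
Definition zmod_pred : {pred M} := [pred x | x \in N].

Lemma zmod_pred_closed : zmod_closed zmod_pred.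
Proof. exact: GRing.submod_closedB (submodClosedP N). Qed.

HB.instance Definition _ := GRing.isZmodClosed.Build M zmod_pred zmod_pred_closed.

Definition quotient_module : Type := @Quotient.quot M zmod_pred.

HB.instance Definition _ := GRing.Zmodule.on quotient_module.

Definition quotient_proj : M -> quotient_module :=
  \pi_(@Quotient.quot M zmod_pred).

Lemma quotient_proj_eq (v w : M) :
  (quotient_proj v == quotient_proj w) = (v - w \in N).
Proof. by rewrite -[RHS]/(v - w \in zmod_pred) Quotient.idealrBE. Qed.

Lemma quotient_proj_surj (x : quotient_module) : exists v, x = quotient_proj v.
Proof. by exists (repr x); rewrite /quotient_proj reprK. Qed.

Lemma quotient_projD : {morph quotient_proj : v w / v + w}.
Proof. exact: raddfD. Qed.

Definition quotient_scale (a : R) (x : quotient_module) : quotient_module :=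
  quotient_proj (a *: repr x).

Lemma quotient_scale_proj (a : R) (v : M) :
  quotient_scale a (quotient_proj v) = quotient_proj (a *: v).
Proof.
apply/eqP; rewrite quotient_proj_eq -scalerBr rpredZ // -quotient_proj_eq.
by rewrite /quotient_proj reprK.
Qed.

Lemma quotient_scaleA (a b : R) (x : quotient_module) :
  quotient_scale a (quotient_scale b x) = quotient_scale (a * b) x.
Proof.
by have [v ->] := quotient_proj_surj x; rewrite !quotient_scale_proj scalerA.
Qed.

Lemma quotient_scale1 : left_id 1 quotient_scale.
Proof.
by move=> x; have [v ->] := quotient_proj_surj x; rewrite quotient_scale_proj scale1r.
Qed.

Lemma quotient_scaleDr : right_distributive quotient_scale +%R.
Proof.
move=> a x y; have [v ->] := quotient_proj_surj x.
have [w ->] := quotient_proj_surj y.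
by rewrite -quotient_projD !quotient_scale_proj scalerDr quotient_projD.
Qed.

Lemma quotient_scaleDl (x : quotient_module) :
  {morph quotient_scale^~ x : a b / a + b}.
Proof.
move=> a b; have [v ->] := quotient_proj_surj x.
by rewrite !quotient_scale_proj scalerDl quotient_projD.
Qed.

HB.instance Definition _ := GRing.Zmodule_isLmodule.Build R quotient_module
  quotient_scaleA quotient_scale1 quotient_scaleDr quotient_scaleDl.
End QuotientModule.

(* [N / (N :&: P)], the trace of [P] on [N] being the submodule divided out. *)
Section Subquotient.
Variables (R : pzRingType) (M : lmodType R) (N P : submodClosed M).

Definition trace_submodule : {pred submodule N} := [pred x | val x \in P].

Lemma trace_submodule_closed : GRing.subsemimod_closed trace_submodule.
Proof.
apply: GRing.submod_closed_semi; split=> [|a u v]; rewrite !inE.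
  by rewrite raddf0 rpred0.
by move=> uP vP; rewrite linearP rpredD ?rpredZ.
Qed.

HB.instance Definition _ :=
  GRing.isSubmodClosed.Build R (submodule N) trace_submodule
    trace_submodule_closed.

Definition subquotient : lmodType R := quotient_module trace_submodule.
End Subquotient.

Section RegularLocalRings.
Variable R : comUnitRingType.

(* Unlike [idealr_closed], this allows the unit ideal. *)
Definition ideal (I : {pred R}) : Prop :=
  GRing.submod_closed (I : {pred R^o}).

Definition generates (n : nat) (g : 'I_n -> R) (I : {pred R}) : Prop :=
  forall x, x \in I <-> exists c : 'I_n -> R, x = \sum_(i < n) c i * g i.

Definition noetherian : Prop :=
  forall I : {pred R}, ideal I ->
    exists (n : nat) (g : 'I_n -> R), generates g I.

Definition prime_ideal (P : {pred R}) : Prop :=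
  idealr_closed P /\ prime_idealr_closed P.

Definition maximal_ideal (m : {pred R}) : Prop :=
  idealr_closed m /\
  forall J : {pred R}, idealr_closed J -> {subset m <= J} -> J =i m.

Definition local_ring (m : {pred R}) : Prop :=
  maximal_ideal m /\ forall m' : {pred R}, maximal_ideal m' -> m' =i m.

Definition has_krull_dim (d : nat) : Prop := max_chain_length prime_ideal d.

Definition regular_local_ring (m : {pred R}) (d : nat) : Prop :=
  [/\ noetherian, local_ring m, has_krull_dim d
    & exists g : 'I_d -> R, generates g m].
End RegularLocalRings.

(* A discrete valuation of rank 1, with value group identified with [int].
   The value at [0] is a dummy: [0] is treated as having infinite value. *)
Record discrete_valuation (K : fieldType) := DiscreteValuation {
  valuation :> K -> int;
  valuationM : forall x y, x != 0 -> y != 0 ->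
    valuation (x * y) = valuation x + valuation y;
  valuationD : forall x y, x != 0 -> y != 0 -> x + y != 0 ->
    Num.min (valuation x) (valuation y) <= valuation (x + y);
  valuation_surj : forall n : int, exists2 x, x != 0 & valuation x = n
}.

Section Domination.
Variables (R : idomainType) (nu : discrete_valuation {fraction R}).

Definition valuation_ring : {pred {fraction R}} :=
  [pred f | (f == 0) || (0 <= nu f)].

Definition valuation_max_ideal : {pred {fraction R}} :=
  [pred f | (f == 0) || (0 < nu f)].

Definition dominates (m : {pred R}) : Prop :=
  (forall a : R, tofrac a \in valuation_ring) /\
  (forall a : R, (tofrac a \in valuation_max_ideal) = (a \in m)).

Variables (m : {pred R}) (dom : dominates m).

(* Closure under multiplication by [R] needs [R] to lie in the valuation ring,
   whence the dependence on [dom]. *)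
Definition valuation_ideal (_ : dominates m) (n : nat) : {pred R^o} :=
  [pred f : R^o | (tofrac (f : R) == 0) || (n%:Z <= nu (tofrac (f : R)))].

Lemma valuation_ideal_closed (n : nat) :
  GRing.subsemimod_closed (valuation_ideal dom n).
Proof.
apply: GRing.submod_closed_semi; split=> [|a u v]; rewrite !inE.
  by rewrite tofrac0 eqxx.
rewrite -[a *: u]/((a : R) * (u : R)) tofracD tofracM.
have [->|u0] := eqVneq (tofrac (u : R)) 0; first by rewrite mulr0 add0r.
have [->|a0] := eqVneq (tofrac (a : R)) 0; first by rewrite mul0r add0r.
rewrite orFb => nu_u nu_v; have au0 : tofrac a * tofrac (u : R) != 0.
  by rewrite mulf_neq0.
have nu_au : n%:Z <= nu (tofrac a * tofrac (u : R)).
  rewrite valuationM // -[n%:Z]add0r lerD //.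
  by have := dom.1 a; rewrite inE (negPf a0).
have [v0|v0] := eqVneq (tofrac (v : R)) 0; first by rewrite v0 addr0 nu_au orbT.
have [//|s0] := eqVneq (tofrac a * tofrac (u : R) + tofrac (v : R)) 0.
move: nu_v; rewrite (negPf v0) orFb => nu_v.
by rewrite orFb (le_trans _ (valuationD nu au0 v0 s0)) // le_min nu_au nu_v.
Qed.

HB.instance Definition _ (n : nat) :=
  GRing.isSubmodClosed.Build R R^o (valuation_ideal dom n)
    (valuation_ideal_closed n).
End Domination.

Section QuasiPolynomials.
Variable F : realType.

Definition quasi_polynomial (Q : int -> F) : Prop :=
  exists (d : nat) (a : nat -> int -> F),
    (forall i, (i <= d)%N -> exists2 p : int, 0 < p & periodic (a i) p) /\
    (forall n : int, Q n = \sum_(i < d.+1) a i n * n%:~R ^+ i).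

Definition quasi_polynomial_plus_bounded (f : nat -> F) : Prop :=
  exists Q sigma : int -> F,
    [/\ quasi_polynomial Q,
        exists C : F, forall n, `|sigma n| <= C
      & exists n0 : int, forall n : nat, n0 <= n%:Z -> f n = Q n + sigma n].

Definition transcendental (x : F) : Prop := ~ algebraicOver (ratr : rat -> F) x.
End QuasiPolynomials.

(* Main.v *)
(* Let k be a field and R the localization of k[z,x,y] at the prime (x,y), a regular local ring
   of dimension 2 with residue field k(z).  Fix integers v_0 > 0 and v_(i+1) > 2 v_i, put
   P_(-1) = z, P_0 = y, v_(-1) = 0 and P_(i+1) = P_i^2 - x^(2 v_i - v_(i-1)) P_(i-1), and write
   P_i = x^(v_i) u_i, so that u_(i-1) = u_i^2 - x^(v_(i+1) - 2 v_i) u_(i+1).  Modulo x the u_i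
   become z^(1/2), z^(1/4), ...: the x-adic order on k[x][u_0,u_1,...] is therefore a valuation
   whose residue field is the infinite tower k(z^(1/2^oo)) over k(z), and it dominates R.

   With bits b_i of b, put P^b = prod P_i^(b_i), of degree b in y, and v(b) = sum b_i v_i.  The
   classes of the x^(n - v(b)) P^b with v(b) <= n form a basis of I_n/I_(n+1) over k(z), because
   the binary fractions sum b_i/2^(i+1) are distinct modulo 1.  So l(I_n/I_(n+1)) counts the b
   with v(b) <= n.  For v_i = floor(c 2^i) - 1 one has v(b) = c b - e(b), where e(b) lies between
   the number of binary digits 1 of b and its double.  Hence the count is n/c + o(n), but its
   distance to n/c is unbounded, which a quasi-polynomial plus a bounded function cannot achieve.
   It remains to take c transcendental, which is possible by countability. *)
From HB Require Import structures.
From mathcomp Require Import all_boot all_order all_algebra.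
From mathcomp Require Import generic_quotient ring_quotient.
From mathcomp Require Import all_classical all_reals all_analysis.
From mathcomp Require Import finmap zify ring lra.
Require Import Defs.

Set Implicit Arguments.
Unset Strict Implicit.
Unset Printing Implicit Defensive.

Import Order.TTheory GRing.Theory Num.Theory.
Import numFieldNormedType.Exports.
Local Open Scope classical_set_scope.
Local Open Scope ring_scope.

(** * Length of filtered modules *)

(** The infinite tower of the u_i is never built. Every polynomial is examined at a finite level N,
    where the u_i with i < N are polynomials in x and one parameter that stands, modulo x, for
    z^(1/2^N). The levels agree because the terms of an expansion in the P^b cannot cancel: the
    x-adic order of the sum is the least order of its terms, a number in which N does not occur.

    The excess of the count over n/c is at most logarithmic in n, so both limits are governed by the
    slope 1/c alone; yet it is unbounded along b = 2^N - 1. If the count were a quasi-polynomial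
    plus a bounded function, it would be polynomial up to O(1) on an arithmetic progression, and
    being n/c + o(n) it would be n/c + O(1) there, hence everywhere by monotonicity. For l(R/I_n)
    the same argument applies to differences at consecutive n. *)

Section Flags.
Variables (R : comUnitRingType) (m : {pred R}).
Hypothesis munit : forall a : R, a \notin m -> a \is a GRing.unit.
Variable M : lmodType R.

(** A certificate that a submodule has a filtration with [l] steps, each quotient being generated by
    the nonzero class of an [e] killed by [m], hence a copy of the residue field. *)
Inductive flag : (M -> Prop) -> nat -> Prop :=
| flag_nil (N : M -> Prop) : (forall w, N w <-> w = 0) -> flag N 0
| flag_cons (N N' : M -> Prop) l (e : M) :
    flag N l -> (forall a, a \in m -> N (a *: e)) -> ~ N e ->
    (forall w, N' w <-> exists r w', N w' /\ w = r *: e + w') -> flag N' l.+1.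

Lemma flag_submod N l : flag N l ->
  GRing.submod_closed ([pred w | `[< N w >]] : {pred M}).
Proof.
elim=> {N l} [N N0|N N' l e _ [N0 Nlin] me Ne N'E].
  split; first by apply/asboolP/N0.
  move=> a u w /asboolP /N0 -> /asboolP /N0 ->; apply/asboolP/N0.
  by rewrite scaler0 addr0.
split; first by apply/asboolP/N'E; exists 0, 0; rewrite scale0r addr0; split=> //; apply/asboolP.
move=> a u w /asboolP/N'E [r [u' [Nu ->]]] /asboolP/N'E [s [w' [Nw ->]]].
apply/asboolP/N'E; exists (a * r + s), (a *: u' + w'); split.
  by apply/asboolP/Nlin; apply/asboolP.
by rewrite scalerDr scalerA scalerDl !addrA; congr (_ + _); rewrite -!addrA [s *: _ + _]addrC.
Qed.

(** This bounds chains of submodules without Jordan-Hölder: [d S] counts the steps of the flag at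
    which S contains an element of the larger submodule outside the smaller one. It cannot stay
    constant along a strict inclusion inside N, because each step is one-dimensional over the
    residue field. *)
Lemma flag_rank N l : flag N l -> exists d : {pred M} -> nat,
  (forall S, (d S <= l)%N) /\
  forall S S' : {pred M}, GRing.submod_closed S -> GRing.submod_closed S' ->
    {subset S <= S'} -> (d S <= d S')%N /\
    (d S = d S' -> forall w, w \in S' -> N w -> w \in S).
Proof.
elim=> {N l} [N N0|N N' l e Nf [d [dl dS]] me Ne N'E].
  exists (fun=> 0%N); split=> // S S' [S0 _] _ _; split=> // _ w _ /N0 ->//.
pose b (S : {pred M}) := `[< exists w, [/\ w \in S, N' w & ~ N w] >].
exists (fun S => d S + b S)%N; split=> [S|S S' Ssub S'sub SS'].
  by rewrite -addn1 leq_add ?dl // leq_b1.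
have [dle deq] := dS _ _ Ssub S'sub SS'.
have ble : (b S <= b S')%N.
  case bS : (b S) => //; move/asboolP: bS => [w [wS N'w Nw]].
  suff -> : b S' by []. apply/asboolP; exists w; split=> //; exact: SS'.
split=> [|eqd w wS' N'w]; first by rewrite leq_add.
have [d_eq b_eq] : d S = d S' /\ nat_of_bool (b S) = b S'.
  by move: dle ble eqd; clear; lia.
have [Nw|Nw] := pselect (N w); first exact: deq.
have : b S' by apply/asboolP; exists w.
move: b_eq; case: (b S') => //; case bS : (b S) => // _ _.
move/asboolP: bS => [s [sS /N'E [r [s' [Ns' sE]]] Ns]].
move/N'E: N'w => [q [w' [Nw' wE]]].
have [NZ0 Nlin] := flag_submod Nf.
have Nl a u t : N u -> N t -> N (a *: u + t).
  by move=> Nu Nt; apply/asboolP/Nlin; apply/asboolP.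
(* As s = r e + s' lies outside N, the coefficient r is a unit. Subtracting (q/r) s from w
   eliminates e and leaves an element of N, to which the induction hypothesis applies. *)
have rm : r \notin m.
  apply/negP => rm; apply: Ns; rewrite sE.
  by rewrite -[X in X + _]scale1r; apply: Nl => //; apply: me.
have ru := munit rm.
have wE2 : w = (q / r) *: s + (w - (q / r) *: s) by rewrite addrC subrK.
have [_ Slin] := Ssub; have [_ S'lin] := S'sub.
rewrite wE2; apply: (Slin) => //; apply: deq => //.
  by rewrite addrC -scaleNr; apply: S'lin => //; apply: SS'.
have -> : w - (q / r) *: s = (- (q / r)) *: s' + w'.
  by rewrite wE sE scalerDr scalerA divrK // [q *: e + w']addrC opprD addrA addrK addrC scaleNr.
exact: Nl.
Qed.

Lemma flag_chain N l : flag N l -> exists S : nat -> {pred M},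
  [/\ forall i, (i <= l)%N -> GRing.submod_closed (S i),
    forall i, (i < l)%N -> {subset S i <= S i.+1} /\ ~ {subset S i.+1 <= S i}
  & forall w, w \in S l <-> N w].
Proof.
elim=> {N l} [N N0|N N' l e Nf [S [Ssub Sst SN]] me Ne N'E].
  exists (fun=> ([pred w | `[< N w >]] : {pred M})); split=> // [i _|w].
    by apply: (@flag_submod _ 0); apply: flag_nil.
  by split=> [/asboolP|Nw]; last apply/asboolP.
pose T : {pred M} := [pred w | `[< N' w >]].
have Tsub : GRing.submod_closed T.
  by apply: (@flag_submod _ l.+1); apply: (flag_cons Nf me Ne N'E).
exists (fun i => if (i <= l)%N then S i else T); split.
- by move=> i _; case: ifP => // /Ssub.
- move=> i; rewrite ltnS => il; rewrite il; case: ltnP => [il'|li]; first exact: Sst.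
  have -> : i = l by apply/eqP; rewrite eqn_leq il.
  split=> [w /SN Nw|sub].
    by apply/asboolP/N'E; exists 0, w; rewrite scale0r add0r.
  apply: Ne; apply/SN/sub; apply/asboolP/N'E; exists 1, 0.
  rewrite scale1r addr0; split=> //.
  by have [N0 _] := flag_submod Nf; apply/asboolP.
- move=> w; rewrite ltnn; split=> [/asboolP|Nw] //; exact/asboolP.
Qed.

Lemma flag_length N l : flag N l -> (forall w, N w) -> has_length M l.
Proof.
move=> Nf Nall; split.
  by have [S [Ssub Sst _]] := flag_chain Nf; exists S.
move=> k [S [Ssub Sst]]; have [d [dl dS]] := flag_rank Nf.
apply: leq_trans (dl (S k)); suff H i : (i <= k)%N -> (i <= d (S i))%N by exact: H.
elim: i => // i IH ik; apply: leq_ltn_trans (IH (ltnW ik)) _.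
have [Ssub1 Ssub2] := Sst _ ik.
have [le eq] := dS _ _ (Ssub _ (ltnW ik)) (Ssub _ ik) Ssub1.
rewrite ltn_neqAle le andbT; apply/eqP => E; apply: Ssub2 => w wS.
exact: (eq E).
Qed.

(** The classes of the [e i] form a basis of N'/N over the residue field; they are adjoined one at a
    time, independence keeping each outside the span of N and its predecessors. *)
Lemma flag_add (N : M -> Prop) l (e : nat -> M) (k : nat) (N' : M -> Prop) :
  flag N l -> (forall a i, (i < k)%N -> a \in m -> N (a *: e i)) ->
  1 \notin m ->
  (forall r : nat -> R, N (\sum_(i < k) r i *: e i) ->
     forall i, (i < k)%N -> r i \in m) ->
  (forall w, N' w <-> exists (r : nat -> R) w', N w' /\
     w = \sum_(i < k) r i *: e i + w') ->
  flag N' (l + k).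
Proof.
move=> Nf me m1 indep; elim: k me indep N' => [|k IH] me indep N' N'E.
  rewrite addn0; suff -> : N' = N by [].
  apply/funext => w; apply/propext; split=> [/N'E [r [w' [Nw']]]|Nw].
    by rewrite big_ord0 add0r => ->.
  by apply/N'E; exists (fun=> 0), w; rewrite big_ord0 add0r.
pose N1 w := exists (r : nat -> R) w', N w' /\ w = \sum_(i < k) r i *: e i + w'.
have [NZ0 Nlin] := flag_submod Nf.
have N0 : N 0 by apply/asboolP.
have Nl a u t : N u -> N t -> N (a *: u + t).
  by move=> Nu Nt; apply/asboolP/Nlin; apply/asboolP.
have N1f : flag N1 (l + k).
  apply: IH => // [a i ik|r Nr i ik]; first by apply: me; apply: ltnW.
  have := indep (fun i => if (i < k)%N then r i else 0) _ i.
  rewrite ik ltnS (ltnW ik) => -> //; rewrite big_ord_recr /= ltnn scale0r addr0.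
  by under eq_bigr => j _ do rewrite ltn_ord.
rewrite addnS; apply: (flag_cons (e := e k) N1f).
- move=> a am; exists (fun=> 0), (a *: e k); split; first by apply: me.
  by rewrite big1 ?add0r // => i _; rewrite scale0r.
- move=> [r [w' [Nw' ek]]].
  (* If [e k] were in the previous span, this would be a relation modulo N with coefficient 1 at
     [e k], forcing 1 into [m]. *)
  pose r' i := if (i < k)%N then - r i else 1.
  have : r' k \in m.
    apply: (indep r') => //; rewrite big_ord_recr /= {2}/r' ltnn scale1r.
    rewrite [in X in _ + X]ek addrA -big_split /= big1 ?add0r //.
    by move=> i _; rewrite /r' ltn_ord scaleNr addNr.
  by rewrite /r' ltnn; apply/negP.
- move=> w; split=> [/N'E [r [w' [Nw' ->]]]|[a [w' [[r [w'' [Nw'' ->]]] ->]]]].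
    exists (r k), (\sum_(i < k) r i *: e i + w'); split; first by exists r, w'.
    by rewrite big_ord_recr /= [_ + r k *: _]addrC addrA.
  apply/N'E; exists (fun i => if (i < k)%N then r i else a), w''; split=> //.
  rewrite big_ord_recr /= ltnn addrA [a *: _ + _]addrC; congr (_ + _ + _).
  by apply: eq_bigr => i _; rewrite ltn_ord.
Qed.
End Flags.

Lemma quotient_projZ (R : pzRingType) (M : lmodType R) (N : submodClosed M) (a : R) (u : M) :
  quotient_proj N (a *: u) = a *: quotient_proj N u.
Proof. by rewrite -quotient_scale_proj. Qed.

Lemma quotient_proj0 (R : pzRingType) (M : lmodType R) (N : submodClosed M) (u : M) :
  quotient_proj N u = 0 <-> u \in N.
Proof.
have z : quotient_proj N 0 = 0 by rewrite -[in LHS](scale0r (0 : M)) quotient_projZ scale0r.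
by rewrite -z; split=> [/eqP|uN]; last apply/eqP; rewrite quotient_proj_eq subr0.
Qed.

Lemma quotient_proj_sum (R : pzRingType) (M : lmodType R) (N : submodClosed M) n
    (r : nat -> R) (e : nat -> M) :
  quotient_proj N (\sum_(i < n) r i *: e i) = \sum_(i < n) r i *: quotient_proj N (e i).
Proof.
elim: n => [|n IH]; first by rewrite !big_ord0; apply/quotient_proj0/rpred0.
by rewrite !big_ord_recr /= quotient_projD IH quotient_projZ.
Qed.

Lemma submodule_valZ (R : comUnitRingType) (N : submodClosed R^o) (a : R) (u : submodule N) :
  val (a *: u) = a * (val u : R).
Proof. by []. Qed.

(** * Lengths of R/I_n and I_n/I_(n+1) from bases of the graded pieces *)

Section Lengths.
Variables (R : comUnitRingType) (m : {pred R}) (I : nat -> submodClosed R^o).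
Hypothesis munit : forall a : R, a \notin m -> a \is a GRing.unit.
Hypothesis m1 : 1 \notin m.
Hypothesis I_full : forall r : R, r \in I 0%N.
Hypothesis I_leq : forall i n (r : R), (i <= n)%N -> r \in I n -> r \in I i.
Hypothesis I_max : forall n (a u : R), a \in m -> u \in I n -> a * u \in I n.+1.

Variables (c : nat -> nat) (gen : nat -> nat -> R).
Hypothesis gen_in : forall n b, (b < c n)%N -> gen n b \in I n.
Hypothesis gen_span : forall n (r : R), r \in I n ->
  exists s : nat -> R, r - \sum_(b < c n) s b * gen n b \in I n.+1.
Hypothesis gen_indep : forall n (r : nat -> R), \sum_(b < c n) r b * gen n b \in I n.+1 ->
  forall b, (b < c n)%N -> r b \in m.

Let I0 n : (0 : R) \in I n. Proof. exact: (rpred0 (I n)). Qed.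
Let ID n (u u' : R) : u \in I n -> u' \in I n -> u + u' \in I n.
Proof. exact: (@rpredD _ (I n)). Qed.
Let IM n (a u : R) : u \in I n -> a * u \in I n.
Proof. by move=> uI; apply: (rpredZ a (uI : (u : R^o) \in I n)). Qed.

Lemma quotient_length n :
  has_length (quotient_module (I n)) (\sum_(i < n) c i).
Proof.
pose M : lmodType R := quotient_module (I n).
pose pi (f : R) : M := @quotient_proj R R^o (I n) f.
pose Ng g (z : M) := exists f, f \in I g /\ z = pi f.
(* R/I_n is filtered by the images of I_n, I_(n-1), ..., I_0; the step from I_(g+1) to I_g adds
   [c g] to the length. *)
suff H j : (j <= n)%N -> flag m (Ng (n - j)%N) (\sum_(n - j <= i < n) c i).
  have := H n (leqnn n); rewrite subnn big_mkord => Hn.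
  apply: (flag_length munit Hn) => z.
  have [f ->] := quotient_proj_surj z; exists f; split=> //.
elim: j => [_|j IH jn].
  rewrite subn0 big_geq //; apply: flag_nil => z; split=> [[f [fI ->]]|->].
    exact/quotient_proj0.
  by exists 0; split; [apply: I0|apply/esym/quotient_proj0/I0].
have [g gE] : exists g, (n - j = g.+1)%N by exists (n - j.+1)%N; lia.
have gE' : (n - j.+1 = g)%N by lia.
have gn : (g.+1 <= n)%N by lia.
move: (IH (ltnW jn)); rewrite gE gE' => {}IH.
rewrite big_ltn // addnC.
have NgP f h : pi f = pi h -> f - h \in I n.
  by move/eqP; rewrite quotient_proj_eq.
have memNg i f : (i <= n)%N -> Ng i (pi f) -> f \in I i.
  move=> le [h [hI /NgP /(I_leq le) fh]].
  by rewrite -[f](subrK h); apply: ID.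
apply: (@flag_add R m M (Ng g.+1) _ (fun b => pi (gen g b))) => //.
- move=> a b bc am; exists (a * gen g b); split; last exact/esym/quotient_projZ.
  by apply: I_max => //; apply: gen_in.
- move=> r; rewrite -(@quotient_proj_sum R R^o (I n)) => /(memNg _ _ gn).
  by move=> /(@gen_indep _ _).
- move=> z; split=> [[f [fI ->]]|[r [_ [[f [fI ->]] ->]]]].
    have [s sI] := gen_span fI.
    exists s, (pi (f - \sum_(b < c g) s b * gen g b)).
    split; first by exists (f - \sum_(b < c g) s b * gen g b); split; [exact: sI|].
    rewrite -(@quotient_proj_sum R R^o (I n)) -quotient_projD; congr quotient_proj.
    by rewrite addrC subrK.
  rewrite -(@quotient_proj_sum R R^o (I n)) -quotient_projD.
  exists (\sum_(b < c g) r b * gen g b + f); split; last by [].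
  apply: ID; last first.
    exact: I_leq (leqnSn _) fI.
  elim/big_rec: _ => [|b z' _ zI]; first exact: I0.
  by apply: (ID _ zI); apply: IM; apply: gen_in.
Qed.

Lemma subquotient_length n : has_length (subquotient (I n) (I n.+1)) (c n).
Proof.
pose P : {pred submodule (I n)} := trace_submodule (I n.+1).
pose M : lmodType R := quotient_module P.
pose sub (f : R) : submodule (I n) := insubd 0 (f : R^o).
have subK f : f \in I n -> val (sub f) = f by move=> fI; rewrite /sub insubdK.
have gI b : (b < c n)%N -> gen n b \in I n by apply: gen_in.
have valS (r : nat -> R) : val (\sum_(b < c n) r b *: sub (gen n b)) = \sum_(b < c n) r b * gen n b.
  rewrite raddf_sum; apply: eq_bigr => b _.
  by apply: etrans (submodule_valZ _ _) _; congr (_ * _); apply: subK; apply: gI.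
pose N0 (z : M) := z = 0.
have f0 : flag m N0 0 by apply: flag_nil.
apply: (@flag_length R m munit M (fun=> True) (0 + c n)) => //.
apply: (@flag_add R m M N0 _ (fun b => quotient_proj P (sub (gen n b)))) => //.
- move=> a b bc am; apply: etrans (esym (quotient_projZ _ _ _)) _.
  apply/quotient_proj0; rewrite inE.
  rewrite submodule_valZ (subK _ (gI b bc)).
  by apply: (I_max am); apply: gI.
- move=> r; rewrite /N0 -(@quotient_proj_sum R _ _ (c n) r (fun b => sub (gen n b))).
  move=> /quotient_proj0; rewrite inE valS.
  by move=> /(@gen_indep _ _).
- move=> z; split=> // _; have [u ->] := quotient_proj_surj z.
  have [s sI] := gen_span (valP u).
  exists s, 0; split=> //; rewrite addr0 -(@quotient_proj_sum R _ _ (c n) s (fun b => sub (gen n b))); apply/eqP.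
  by rewrite quotient_proj_eq inE raddfB /= valS.
Qed.
End Lengths.

(** * Noetherian rings and localization *)

Lemma ideal_sum (R : comUnitRingType) (I : {pred R}) n (c g : 'I_n -> R) :
  ideal I -> (forall i, g i \in I) -> \sum_(i < n) c i * g i \in I.
Proof.
move=> [I0 Ilin] gI; elim/big_rec: _ => [//|i w _ wI].
exact: (Ilin (c i) (g i) w (gI i) wI).
Qed.

(** Characterizing the ideal generated by [s] as the least one containing it spares the basis
    theorem all bookkeeping of coefficients. *)
Lemma fin_gen (R : comUnitRingType) (I : {pred R}) (s : seq R) :
  ideal I -> {subset s <= I} ->
  (forall x, x \in I -> forall J : {pred R}, ideal J -> {subset s <= J} -> x \in J) ->
  exists (n : nat) (g : 'I_n -> R), generates g I.
Proof.
move=> Iid sI Imin; exists (size s), (fun i => s`_i) => x; split=> [xI|[c ->]]; last first.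
  by apply: ideal_sum => // i; apply: sI; apply: mem_nth.
pose J : {pred R} := [pred x | `[< exists c : 'I_(size s) -> R, x = \sum_(i < size s) c i * s`_i >]].
suff : x \in J by move/asboolP.
apply: Imin => //.
  split; first by apply/asboolP; exists (fun=> 0); rewrite big1 // => i; rewrite mul0r.
  move=> a _ _ /asboolP [c ->] /asboolP [d ->]; apply/asboolP.
  exists (fun i => a * c i + d i); rewrite -[LHS]/(a * _ + _) mulr_sumr -big_split /=.
  by apply: eq_bigr => i _; rewrite mulrDl mulrA.
move=> g gs; apply/asboolP; have gi : (index g s < size s)%N by rewrite index_mem.
exists (fun i => (i == Ordinal gi)%:R); rewrite (bigD1 (Ordinal gi)) //= eqxx mul1r nth_index //.
by rewrite big1 ?addr0 // => j /negPf ->; rewrite mul0r.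
Qed.

(** * Hilbert's basis theorem *)

Section HilbertBasis.
Variable A : idomainType.
Hypothesis Anoeth : noetherian A.

(** The size is bounded rather than prescribed so that 0 is included and the set is an ideal. *)
Definition lead (I : {pred {poly A}}) (n : nat) : {pred A} :=
  [pred a | `[< exists p, [/\ p \in I, (size p <= n.+1)%N & p`_n = a] >]].

Lemma leadP (I : {pred {poly A}}) n a :
  reflect (exists p, [/\ p \in I, (size p <= n.+1)%N & p`_n = a]) (a \in lead I n).
Proof. exact: asboolP. Qed.

Lemma ideal_lead (I : {pred {poly A}}) n : ideal I -> ideal (lead I n).
Proof.
move=> [I0 Ilin]; split; first by apply/leadP; exists 0; rewrite size_poly0 coef0.
move=> a _ _ /leadP [p [pI ps <-]] /leadP [q [qI qs <-]].
apply/leadP; exists (a%:P * p + q); split; first exact: Ilin.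
  by rewrite (leq_trans (size_polyD _ _)) // geq_max qs mul_polyC (leq_trans (size_scale_leq _ _)).
by rewrite coefD coefCM.
Qed.

Lemma lead_leq (I : {pred {poly A}}) n m : ideal I -> (n <= m)%N -> {subset lead I n <= lead I m}.
Proof.
move=> [I0 Ilin] nm _ /leadP [p [pI ps <-]]; apply/leadP.
exists ('X^(m - n) * p + 0); split; first exact: Ilin.
  rewrite addr0 mulrC; apply: leq_trans (size_polyMleq _ _) _.
  by rewrite size_polyXn; move: ps nm; clear; lia.
by rewrite addr0 coefXnM ltnNge leq_subr /= subKn.
Qed.

(** The union of this increasing chain is an ideal, and its finitely many generators already lie in
    a common member. *)
Lemma lead_stable (I : {pred {poly A}}) : ideal I ->
  exists N, forall n, (N <= n)%N -> {subset lead I n <= lead I N}.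
Proof.
move=> Iid; pose J : {pred A} := [pred a | `[< exists n, a \in lead I n >]].
have Jid : ideal J.
  split; first by apply/asboolP; exists 0%N; have [] := ideal_lead 0 Iid.
  move=> a u w /asboolP [n un] /asboolP [m wm]; apply/asboolP; exists (maxn n m).
  have [_ lin] := ideal_lead (maxn n m) Iid.
  by apply: lin; [apply: lead_leq un; rewrite ?leq_maxl|apply: lead_leq wm; rewrite ?leq_maxr].
have [r [g gJ]] := Anoeth Jid.
have gin i : exists n, g i \in lead I n.
  apply/asboolP; rewrite -[asbool _]/(g i \in J); apply/gJ.
  exists (fun j => (j == i)%:R); rewrite (bigD1 i) //= eqxx mul1r big1 ?addr0 //.
  by move=> j /negPf ->; rewrite mul0r.
have /choice [N NP] := gin.
exists (\max_i N i) => n _ a an.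
have /gJ [c ->] : a \in J by apply/asboolP; exists n.
apply: ideal_sum; first exact: ideal_lead.
by move=> i; apply: lead_leq (NP i) => //; apply: leq_bigmax.
Qed.


Theorem noetherian_poly : noetherian {poly A}.
Proof.
move=> I Iid; have [N NP] := lead_stable Iid.
(* In each degree finitely many elements of I realize all leading coefficients. The union of these
   sets over degrees at most N generates I, by induction on the size: the leading term is always
   cancelled. *)
have gen m : exists s : seq {poly A}, {subset s <= I} /\
    forall a, a \in lead I m -> exists q : {poly A}, [/\ (size q <= m.+1)%N, q`_m = a &
      forall J : {pred {poly A}}, ideal J -> {subset s <= J} -> q \in J].
  have [r [g gI]] := Anoeth (ideal_lead m Iid).
  have /choice [p pP] i : exists p, [/\ p \in I, (size p <= m.+1)%N & p`_m = g i].
    apply/leadP/gI; exists (fun j => (j == i)%:R); rewrite (bigD1 i) //= eqxx mul1r big1 ?addr0 //.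
    by move=> j /negPf ->; rewrite mul0r.
  exists [seq p i | i <- enum 'I_r]; split=> [_ /mapP [i _ ->]|a /gI [c ->]].
    by have [] := pP i.
  exists (\sum_(i < r) (c i)%:P * p i); split.
  - apply: leq_trans (size_sum _ _ _) _; apply/bigmax_leqP => i _.
    by rewrite mul_polyC (leq_trans (size_scale_leq _ _)) //; have [] := pP i.
  - by rewrite coef_sum; apply: eq_bigr => i _; rewrite coefCM; have [_ _ ->] := pP i.
  - by move=> J Jid sJ; apply: ideal_sum => // i; apply: sJ; apply: map_f; rewrite mem_enum.
have /choice [s sP] := gen.
pose t := flatten [seq s m | m <- iota 0 N.+1].
apply: (@fin_gen _ _ t) => // [y /flattenP [s' /mapP [m _ ->] ys]|].
  exact: (sP m).1.
move=> x xI J Jid tJ; suff H n : forall p : {poly A}, p \in I -> (size p < n)%N -> p \in J by exact: H xI (ltnSn _).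
elim: n {x xI} => // n IHn x xI; rewrite ltnS => xn; have [->|x0] := eqVneq x 0; first by have [] := Jid.
pose d := (size x).-1; have sx : size x = d.+1 by rewrite prednK // size_poly_gt0.
(* Beyond degree N the leading coefficients are those of degree N, so an element of degree [m]
   multiplied by X^(d - m) cancels the leading term of [x]. *)
pose m := minn d N.
have xd : x`_d \in lead I m.
  have : x`_d \in lead I d by apply/leadP; exists x; rewrite sx.
  by rewrite /m; case: leqP => // Nd; apply: NP; apply: ltnW.
have [q [qm qd qJ]] := (sP m).2 _ xd.
have sJ (J' : {pred {poly A}}) : {subset t <= J'} -> {subset s m <= J'}.
  move=> tJ' y ys; apply: tJ'; apply/flattenP; exists (s m) => //.
  by apply: map_f; rewrite mem_iota add0n ltnS geq_minr.
have qJ' := qJ _ Jid (sJ _ tJ).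
have qI : q \in I by apply: qJ => //; apply: (sP m).1.
have mul_in (K : {pred {poly A}}) a u w : ideal K -> u \in K -> w \in K -> a * u + w \in K.
  by move=> [_ lin]; apply: lin.
have -> : x = 'X^(d - m) * q + (- 'X^(d - m) * q + x) by rewrite mulNr addrA subrr add0r.
apply: (mul_in) => //; apply: IHn; first exact: mul_in.
apply: leq_trans xn; rewrite sx ltnS; apply/leq_sizeP => j dj.
rewrite coefD mulNr coefN coefXnM; have md : (m <= d)%N by rewrite geq_minl.
case: ltnP => [|_]; first by move: dj md; clear; lia.
move: dj; rewrite leq_eqVlt => /orP [/eqP <-|dj]; first by rewrite subKn // qd addNr.
have -> : x`_j = 0 by apply: nth_default; rewrite sx.
rewrite addr0; suff -> : q`_(j - (d - m)) = 0 by rewrite oppr0.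
by apply: nth_default; apply: leq_trans qm _; move: dj md; clear; lia.
Qed.
End HilbertBasis.

Lemma noetherian_field (k : fieldType) : noetherian k.
Proof.
move=> I [I0 Ilin].
have Iin a u : u \in I -> a * u \in I by move=> uI; rewrite -[a * u]addr0; apply: Ilin.
have [[u [uI u0]]|no] := pselect (exists u, u \in I /\ u != 0).
  exists 1%N, (fun=> u) => x; split=> [_|[c ->]]; last by rewrite big_ord1; apply: Iin.
  by exists (fun=> x / u); rewrite big_ord1 divfK.
exists 0%N, (fun=> 0) => x; split=> [xI|[c ->]]; last by rewrite big_ord0.
exists (fun=> 0); rewrite big_ord0; apply/eqP/negPn/negP => x0; apply: no.
by exists x.
Qed.

(* The prime ideal to localize at is given as the kernel of [rho]. *)
Section Localization.
Variables (S A : idomainType) (rho : {rmorphism S -> A}).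
Local Notation "x %:F" := (@tofrac S x).

Definition loc_pred : {pred {fraction S}} :=
  [pred q | `[< exists f g, rho g != 0 /\ q = f%:F / g%:F >]].

Lemma rho_neq0 g : rho g != 0 -> g%:F != 0.
Proof. by rewrite tofrac_eq0; apply: contra_neq => ->; rewrite rmorph0. Qed.

Lemma loc_subring : GRing.subring_closed loc_pred.
Proof.
split=> [|_ _ /asboolP [f [g [g0 ->]]] /asboolP [f' [g' [g0' ->]]]|
          _ _ /asboolP [f [g [g0 ->]]] /asboolP [f' [g' [g0' ->]]]].
- by apply/asboolP; exists 1, 1; rewrite rmorph1 oner_neq0 tofrac1 divr1.
- apply/asboolP; exists (f * g' - f' * g), (g * g'); rewrite rmorphM mulf_neq0 //.
  split=> //; rewrite tofracB !tofracM -mulNr addf_div ?rho_neq0 // mulNr.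
  by rewrite [f'%:F * _]mulrC.
- apply/asboolP; exists (f * f'), (g * g'); rewrite rmorphM mulf_neq0 //.
  by split=> //; rewrite !tofracM mulf_div.
Qed.

HB.instance Definition _ := GRing.isSubringClosed.Build _ loc_pred loc_subring.

Definition loc : Type := {q : {fraction S} | loc_pred q}.
HB.instance Definition _ := SubChoice.on loc.
HB.instance Definition _ := [SubChoice_isSubComNzRing of loc by <:].

Lemma loc_valM (p q : loc) : val (p * q) = val p * val q. Proof. by []. Qed.
Lemma loc_valD (p q : loc) : val (p + q) = val p + val q. Proof. by []. Qed.
Lemma loc_valB (p q : loc) : val (p - q) = val p - val q. Proof. by []. Qed.
Lemma loc_val1 : val (1 : loc) = 1. Proof. by []. Qed.

Definition loc_unit : {pred loc} := [pred q : loc | (val q != 0) && ((val q)^-1 \in loc_pred)].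
(** The default [q] of [insubd] realizes the convention that inversion is the identity on
    non-units. *)
Definition loc_inv (q : loc) : loc := insubd q (val q)^-1.

Lemma val_loc_inv q : q \in loc_unit -> val (loc_inv q) = (val q)^-1.
Proof. by case/andP => _ qu; rewrite /loc_inv insubdK. Qed.

Lemma loc_mulVr : {in loc_unit, left_inverse 1 loc_inv *%R}.
Proof.
move=> q qu; apply: val_inj; rewrite rmorphM /= val_loc_inv //.
by case/andP: qu => q0 _; rewrite mulVf.
Qed.

Lemma loc_unitP q p : p * q = 1 -> q \in loc_unit.
Proof.
move=> /(congr1 val); rewrite rmorphM rmorph1 /= => pq; have q0 : val q != 0.
  by apply: contraTneq (oner_neq0 {fraction S}) => q0; rewrite -pq q0 mulr0 eqxx.
rewrite inE q0 /=; suff -> : (val q)^-1 = val p by apply: (valP p).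
by apply: (mulIf q0); rewrite mulVf.
Qed.

Lemma loc_inv_out : {in [predC loc_unit], loc_inv =1 id}.
Proof.
move=> q qu; rewrite /loc_inv /insubd; case: insubP => //= u uP uE.
apply: val_inj; apply: etrans uE _; have [q0|q0] := eqVneq (val q) 0.
  by move: (q0) => /= ->; rewrite invr0.
by case/negP: qu; apply/andP.
Qed.

HB.instance Definition _ :=
  GRing.ComNzRing_hasMulInverse.Build loc loc_mulVr loc_unitP loc_inv_out.

Lemma loc_integral : GRing.integral_domain_axiom loc.
Proof.
move=> p q /(congr1 val); rewrite rmorphM rmorph0 /= => /eqP.
by rewrite mulf_eq0 -!(inj_eq val_inj) rmorph0.
Qed.
HB.instance Definition _ := GRing.ComUnitRing_isIntegral.Build loc loc_integral.

Lemma locP (q : loc) : exists f g, rho g != 0 /\ val q = f%:F / g%:F.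
Proof. by apply/asboolP; exact: (valP q). Qed.

Lemma loc_of_subproof f g : rho g != 0 -> loc_pred (f%:F / g%:F).
Proof. by move=> g0; apply/asboolP; exists f, g. Qed.

Definition loc_mk f g (g0 : rho g != 0) : loc := Sub (f%:F / g%:F) (loc_of_subproof f g0).

Lemma one_rho : rho 1 != 0. Proof. by rewrite rmorph1 oner_neq0. Qed.
Definition to_loc f : loc := loc_mk f one_rho.

Lemma val_to_loc f : val (to_loc f) = f%:F.
Proof. by rewrite /= tofrac1 divr1. Qed.

Lemma to_loc_is_zmod : zmod_morphism to_loc.
Proof. move=> f g; apply: val_inj; rewrite loc_valB !val_to_loc. by rewrite tofracB. Qed.
Lemma to_loc_is_mul : monoid_morphism to_loc.
Proof.
split; first by apply: val_inj; rewrite val_to_loc tofrac1.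
by move=> f g; apply: val_inj; rewrite loc_valM !val_to_loc tofracM.
Qed.
HB.instance Definition _ := GRing.isZmodMorphism.Build S loc to_loc to_loc_is_zmod.
HB.instance Definition _ := GRing.isMonoidMorphism.Build S loc to_loc to_loc_is_mul.

Lemma to_loc_unit g : rho g != 0 -> to_loc g \is a GRing.unit.
Proof.
move=> g0; apply: (@loc_unitP _ (loc_mk 1 g0)); apply: val_inj.
by rewrite loc_valM loc_val1 val_to_loc /= tofrac1 div1r mulVf ?rho_neq0.
Qed.

Lemma loc_frac (q : loc) : exists f g, rho g != 0 /\ q = to_loc f / to_loc g.
Proof.
have [f [g [g0 qE]]] := locP q; exists f, g; split=> //.
apply: (mulIr (to_loc_unit g0)); rewrite divrK ?to_loc_unit //.
by apply: val_inj; rewrite loc_valM !val_to_loc qE divfK ?rho_neq0.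
Qed.

Lemma loc_common_denom (q : nat -> loc) n : exists (f : nat -> S) g, rho g != 0 /\
  forall i, (i < n)%N -> q i * to_loc g = to_loc (f i).
Proof.
elim: n => [|n [f [g [g0 fE]]]]; first by exists (fun=> 0), 1; split=> //; apply: one_rho.
have [f' [g' [g0' qE]]] := loc_frac (q n).
exists (fun i => if (i < n)%N then f i * g' else f' * g), (g * g').
rewrite rmorphM mulf_neq0 //; split=> // i; rewrite ltnS leq_eqVlt rmorphM.
case/orP=> [/eqP ->|i_n]; last by rewrite i_n mulrA fE // rmorphM.
by rewrite ltnn qE rmorphM [to_loc g * _]mulrC mulrA divrK ?to_loc_unit.
Qed.

Lemma noetherian_loc : noetherian S -> noetherian loc.
Proof.
move=> Snoeth I [I0 Ilin]; pose J : {pred S} := [pred f | to_loc f \in I].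
have Jid : ideal J.
  split; first by rewrite inE rmorph0.
  move=> a u w; rewrite !inE => uI wI.
  by rewrite -[a *: u]/(a * u) rmorphD rmorphM; apply: Ilin.
have [n [g gJ]] := Snoeth J Jid.
have Imul a u : u \in I -> a * u \in I by move=> uI; rewrite -[a * u]addr0; apply: Ilin.
exists n, (fun i => to_loc (g i)) => x; split=> [xI|[c ->]].
  have [f [h [h0 xE]]] := loc_frac x.
  have /gJ [c fE] : f \in J.
    rewrite inE; have -> : to_loc f = to_loc h * x by rewrite xE mulrC divrK ?to_loc_unit.
    exact: Imul.
  exists (fun i => to_loc (c i) / to_loc h); rewrite xE fE rmorph_sum mulr_suml.
  by apply: eq_bigr => i _; rewrite rmorphM mulrAC.
elim/big_rec: _ => [//|i w _ wI]; apply: Ilin => //.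
have : g i \in J by apply/gJ; exists (fun j => (j == i)%:R); rewrite (bigD1 i) //= eqxx mul1r big1 ?addr0 // => j /negPf ->; rewrite mul0r.
by rewrite inE.
Qed.

Section Extension.
Variables (A' : idomainType) (sigma : {rmorphism S -> A'}).
Hypothesis rho_sigma : forall g, rho g != 0 -> sigma g != 0.

(** The extension to the localization of the kernel of [sigma], a prime contained in the kernel of
    [rho]. The identity, reduction modulo x and [rho] itself later give the chain of primes 0, (x),
    (x,y). *)
Definition loc_ker : {pred loc} :=
  [pred q | `[< exists f g, [/\ rho g != 0, sigma f = 0 & q = to_loc f / to_loc g] >]].

Lemma loc_kerE f g : rho g != 0 -> (to_loc f / to_loc g \in loc_ker) = (sigma f == 0).
Proof.
move=> g0; apply/asboolP/eqP => [[f' [g' [g0' f'0 E]]]|f0]; last by exists f, g.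
have {}E : f * g' = f' * g.
  apply/eqP; rewrite -tofrac_eq -!val_to_loc; apply/eqP; congr val; rewrite !rmorphM /=.
  by rewrite -[to_loc f](divrK (to_loc_unit g0)) E mulrAC divrK ?to_loc_unit.
have /eqP := congr1 sigma E; rewrite !rmorphM f'0 mul0r mulf_eq0 (negPf (rho_sigma g0')).
by rewrite orbF => /eqP.
Qed.

Lemma loc_ker_mul a f g : rho g != 0 -> a * to_loc g = to_loc f ->
  (a \in loc_ker) = (sigma f == 0).
Proof. by move=> g0 E; rewrite -(loc_kerE f g0) -E mulrK ?to_loc_unit. Qed.

Lemma loc_ker_to_loc f : (to_loc f \in loc_ker) = (sigma f == 0).
Proof. by rewrite -[to_loc f]divr1 -(rmorph1 to_loc) loc_kerE // one_rho. Qed.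

Lemma loc_ker_prime : prime_ideal loc_ker.
Proof.
split; first split.
- by rewrite -(rmorph0 to_loc) loc_ker_to_loc rmorph0.
- by rewrite -(rmorph1 to_loc) loc_ker_to_loc rmorph1 oner_neq0.
- move=> a u v; have [fa [ga [ga0 aE]]] := loc_frac a.
  have [fu [gu [gu0 ->]]] := loc_frac u; have [fv [gv [gv0 ->]]] := loc_frac v.
  rewrite !loc_kerE // => /eqP u0 /eqP v0.
  rewrite (@loc_ker_mul _ (fa * fu * gv + fv * ga * gu) (ga * gu * gv)).
  - by rewrite rmorphD !rmorphM u0 v0 mulr0 !mul0r addr0.
  - by rewrite !rmorphM !mulf_neq0.
  rewrite aE !(rmorphM, rmorphD) /= mulrDl.
  rewrite -[X in _ = X * _ * _ + _](divrK (to_loc_unit ga0)).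
  rewrite -[X in _ = _ * X * _ + _](divrK (to_loc_unit gu0)).
  by rewrite -[X in _ = _ + X * _ * _](divrK (to_loc_unit gv0)); congr (_ + _); ring.
- move=> u v; have [fu [gu [gu0 ->]]] := loc_frac u; have [fv [gv [gv0 ->]]] := loc_frac v.
  rewrite !loc_kerE // (@loc_ker_mul _ (fu * fv) (gu * gv)) ?rmorphM ?mulf_neq0 ?mulf_eq0 //.
  rewrite -[X in _ = X * _](divrK (to_loc_unit gu0)).
  by rewrite -[X in _ = _ * X](divrK (to_loc_unit gv0)) /=; ring.
Qed.
End Extension.

Definition loc_max : {pred loc} := loc_ker rho.

Lemma loc_max_unit a : a \notin loc_max -> a \is a GRing.unit.
Proof.
have [f [g [g0 ->]]] := loc_frac a; rewrite loc_kerE // => f0.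
by rewrite unitrMl ?unitrV ?to_loc_unit.
Qed.

Lemma loc_local : local_ring loc_max.
Proof.
have proper (J : {pred loc}) : idealr_closed J -> {subset J <= loc_max}.
  move=> [J0 J1 Jlin] a aJ; apply: contraNT J1 => /loc_max_unit au.
  by rewrite -(mulVr au) -[_ * a]addr0; apply: Jlin.
have [max_id _] := @loc_ker_prime _ rho (fun _ => id).
split.
  split=> // J Jid sub a; apply/idP/idP => [|/sub//]; exact: proper.
move=> m' [m'id m'max] a; apply/esym/m'max => //; exact: proper.
Qed.
End Localization.
Arguments loc_max {S A} rho.

(** * Extending an order function to a fraction field *)

Section OrderFunctions.
Import FracField.
Variable D : idomainType.

Definition is_order (w : D -> int) : Prop :=
  (forall x y, x != 0 -> y != 0 -> w (x * y) = w x + w y) /\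
  (forall x y, x != 0 -> y != 0 -> x + y != 0 -> Num.min (w x) (w y) <= w (x + y)).

Variables (w : D -> int) (wo : is_order w).
Local Notation "x %:F" := (@tofrac D x).

Lemma frac_repr (q : {fraction D}) : exists fg : D * D, fg.2 != 0 /\ q = fg.1%:F / fg.2%:F.
Proof.
elim/quotW: q => r; exists ((frac r).1, (frac r).2); split; first exact: denom_ratioP.
have d0 := denom_ratioP r.
apply: (@mulIf _ ((frac r).2)%:F); rewrite ?tofrac_eq0 //= divfK ?tofrac_eq0 //.
rewrite !piE; apply/eqmodP; rewrite /= equivfE /= !numden_Ratio ?oner_neq0 ?mulf_neq0 ?oner_neq0 //.
by rewrite !mulr1 mulrC.
Qed.

(** A representative is picked by choice; [frac_orderE] shows that the value does not depend on
    it. *)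
Definition frac_order (q : {fraction D}) : int :=
  let fg := projT1 (cid (frac_repr q)) in w fg.1 - w fg.2.

Lemma frac_orderE f g : f != 0 -> g != 0 -> frac_order (f%:F / g%:F) = w f - w g.
Proof.
move=> f0 g0; rewrite /frac_order; case: cid => -[f' g'] /= [g0' E].
have fF : f%:F / g%:F != 0 by rewrite mulf_neq0 ?invr_eq0 ?tofrac_eq0.
have f0' : f' != 0 by apply: contraNneq fF => f0'; rewrite E f0' tofrac0 mul0r.
have {}E : f * g' = f' * g.
  apply/eqP; rewrite -tofrac_eq !tofracM; apply/eqP.
  by rewrite -[f%:F](@divfK _ g%:F) ?tofrac_eq0 // E mulrAC divfK ?tofrac_eq0.
have := congr1 w E; rewrite !(wo.1) //; clear; lia.
Qed.

Lemma frac_order_tofrac f : f != 0 -> frac_order f%:F = w f.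
Proof.
move=> f0; rewrite -[f%:F]divr1 -tofrac1 frac_orderE ?oner_neq0 //.
have := wo.1 1 1 (oner_neq0 _) (oner_neq0 _); rewrite mulr1; lia.
Qed.

Lemma frac_order_is : (forall x y : {fraction D}, x != 0 -> y != 0 ->
    frac_order (x * y) = frac_order x + frac_order y) /\
  (forall x y : {fraction D}, x != 0 -> y != 0 -> x + y != 0 ->
    Num.min (frac_order x) (frac_order y) <= frac_order (x + y)).
Proof.
have num0 f g : f%:F / g%:F != 0 -> f != 0.
  by apply: contraNneq => ->; rewrite tofrac0 mul0r.
split=> x y; have [[f g] /= [g0 ->]] := frac_repr x; have [[f' g'] /= [g0' ->]] := frac_repr y.
  move=> /num0 f0 /num0 f0'; rewrite mulf_div -!tofracM !frac_orderE ?mulf_neq0 //.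
  by rewrite !(wo.1) //; lia.
move=> /num0 f0 /num0 f0'; rewrite addf_div ?tofrac_eq0 // -!tofracM -tofracD => /num0 s0.
rewrite !frac_orderE ?mulf_neq0 //.
have := wo.2 _ _ (mulf_neq0 f0 g0') (mulf_neq0 f0' g0) s0.
rewrite !(wo.1) // !ge_min => /orP[] H; apply/orP; [left|right]; move: H; move: (w (_ + _)) (w f) (w g) (w f') (w g'); clear; lia.
Qed.

(** Powers of [t] and their inverses attain all values. The definition is transparent so that
    [loc_valuation_tofrac] can unfold it to [frac_order]. *)
Definition frac_valuation (t : D) (t0 : t != 0) (wt : w t = 1) : discrete_valuation {fraction D}.
Proof.
apply: (@DiscreteValuation _ frac_order frac_order_is.1 frac_order_is.2).
have wtn n : w (t ^+ n) = n%:Z.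
  elim: n => [|n IH]; last by rewrite exprS wo.1 ?expf_neq0 // IH wt; lia.
  have := wo.1 1 1 (oner_neq0 _) (oner_neq0 _); rewrite mulr1 expr0; lia.
move=> [n|n].
  exists (t ^+ n)%:F; first by rewrite tofrac_eq0 expf_neq0.
  by rewrite frac_order_tofrac ?expf_neq0.
exists (1%:F / (t ^+ n.+1)%:F).
  by rewrite mulf_neq0 ?invr_eq0 ?tofrac_eq0 ?expf_neq0 ?oner_neq0.
rewrite frac_orderE ?expf_neq0 ?oner_neq0 // wtn.
have := wtn 0%N; rewrite expr0 => ->; lia.
Defined.
End OrderFunctions.

(** * From an order function on S to a valuation dominating the localization *)

Section LocValuation.
Variables (S A : idomainType) (rho : {rmorphism S -> A}) (w : S -> int) (t : S).
Hypothesis wo : is_order w.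
Hypothesis wpos : forall f, f != 0 -> 0 <= w f /\ (0 < w f) = (rho f == 0).
Hypothesis t0 : t != 0.
Hypothesis wt : w t = 1.
Local Notation R := (loc rho).
Local Notation toR := (to_loc rho).

(** The fraction fields of S and of R are distinct types, so the order is extended from S to its
    fraction field, restricted to R, and extended again to the fraction field of R. *)
Definition rord (r : R) : int := frac_order w (val r).

Lemma rord_is_order : is_order rord.
Proof.
have [M Ad] := frac_order_is wo.
have nz (r : R) : r != 0 -> val r != 0 by apply: contra_neq => r0; apply: val_inj.
split=> x y /nz x0 /nz y0; rewrite /rord; first by rewrite loc_valM M.
by move=> /nz; rewrite loc_valD; apply: Ad.
Qed.

Lemma rord_toR f : f != 0 -> rord (toR f) = w f.
Proof. by move=> f0; rewrite /rord val_to_loc frac_order_tofrac //; apply: wo. Qed.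

Lemma toR_eq0 f : (toR f == 0) = (f == 0).
Proof.
by rewrite -(inj_eq val_inj) val_to_loc -[val 0]/(0 : {fraction S}) tofrac_eq0.
Qed.

(** Denominators lie outside the kernel of [rho], hence have order 0, and the order of a fraction is
    that of its numerator. *)
Lemma rord_ge0 r : r != 0 -> 0 <= rord r /\ (0 < rord r) = (r \in loc_max rho).
Proof.
have [f [g [g0 ->]]] := loc_frac r => fg0.
have gn0 : g != 0 by apply: contraNneq g0 => ->; rewrite rmorph0.
have gu := to_loc_unit g0; have f0 : f != 0.
  by apply: contraNneq fg0 => ->; rewrite rmorph0 mul0r.
have : rord (toR f / toR g * toR g) = rord (toR f / toR g) + rord (toR g).
  by apply: rord_is_order.1; rewrite ?toR_eq0.
rewrite divrK // !rord_toR //; have [wg gE] := wpos gn0; have [wf fE] := wpos f0.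
have {}gE : w g = 0.
  by apply/eqP; rewrite eq_le wg andbT leNgt gE.
rewrite gE addr0 => <-; split=> //.
by rewrite fE; apply/esym/(loc_kerE (fun _ => id) f g0).
Qed.

Lemma toR_t_neq0 : toR t != 0. Proof. by rewrite toR_eq0. Qed.
Lemma rord_t : rord (toR t) = 1. Proof. by rewrite rord_toR. Qed.

Definition loc_valuation : discrete_valuation {fraction R} :=
  @frac_valuation _ _ rord_is_order (toR t) toR_t_neq0 rord_t.

Arguments loc_valuation : simpl never.

Lemma loc_valuation_tofrac (r : R) : r != 0 -> loc_valuation (tofrac r) = rord r.
Proof. exact: (frac_order_tofrac rord_is_order). Qed.

Lemma loc_valuation_dominates : dominates loc_valuation (loc_max rho).
Proof.
split=> a; rewrite !inE tofrac_eq0; have [->|a0] := eqVneq a 0; rewrite ?orTb ?orFb //.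
- by rewrite loc_valuation_tofrac //; have [] := rord_ge0 a0.
- have [[z _ _] _] := @loc_ker_prime _ _ rho _ rho (fun _ => id); exact/esym.
- by rewrite loc_valuation_tofrac //; have [_ ->] := rord_ge0 a0.
Qed.

Local Notation I := (valuation_ideal loc_valuation_dominates).

Lemma valuation_ideal_lin n (a u u' : R) : u \in I n -> u' \in I n -> a * u + u' \in I n.
Proof.
move=> uI uI'; have aI : (a *: (u : R^o)) \in I n by apply: rpredZ.
exact: rpredD aI uI'.
Qed.

Lemma valuation_ideal0 n : (0 : R) \in I n. Proof. exact: (rpred0 (I n)). Qed.
Lemma valuation_idealM n (a u : R) : u \in I n -> a * u \in I n.
Proof. by move=> uI; rewrite -[a * u]addr0; apply: valuation_ideal_lin => //; apply: valuation_ideal0. Qed.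
Lemma valuation_idealE n (r : R) : r != 0 -> (r \in I n) = (n%:Z <= rord r).
Proof. by move=> r0; rewrite inE tofrac_eq0 (negPf r0) orFb loc_valuation_tofrac. Qed.

Lemma valuation_ideal_leq i n (r : R) : (i <= n)%N -> r \in I n -> r \in I i.
Proof.
move=> le; have [->|r0] := eqVneq r 0; first by move=> _; apply: valuation_ideal0.
move=> rI; rewrite (valuation_idealE _ r0); move: rI; rewrite (valuation_idealE _ r0).
by apply: le_trans; rewrite lez_nat.
Qed.

Lemma valuation_ideal_full (r : R) : r \in I 0.
Proof.
by have [->|r0] := eqVneq r 0; rewrite ?valuation_ideal0 // valuation_idealE //; have [] := rord_ge0 r0.
Qed.

Lemma valuation_ideal_maxM n (a u : R) : a \in loc_max rho -> u \in I n -> a * u \in I n.+1.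
Proof.
have [->|a0] := eqVneq a 0; first by move=> _ _; rewrite mul0r; apply: valuation_ideal0.
have [->|u0] := eqVneq u 0; first by move=> _ _; rewrite mulr0; apply: valuation_ideal0.
move=> am uI; rewrite (valuation_idealE _ (mulf_neq0 a0 u0)) (rord_is_order.1 _ _ a0 u0).
move: uI; rewrite (valuation_idealE _ u0); have [_ ] := rord_ge0 a0; rewrite am.
by move: (rord a) (rord u) => p q; clear; lia.
Qed.


Lemma valuation_ideal_to_loc n f : f != 0 -> (toR f \in I n) = (n%:Z <= w f).
Proof. by move=> f0; rewrite valuation_idealE ?toR_eq0 // rord_toR. Qed.

Definition order_ge n f : Prop := f = 0 \/ n%:Z <= w f.

Lemma valuation_ideal_order_ge n f : toR f \in I n <-> order_ge n f.
Proof.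
have [->|f0] := eqVneq f 0.
  by split=> _; [left|rewrite rmorph0; apply: valuation_ideal0].
by rewrite (valuation_ideal_to_loc _ f0); split=> [|[f00|]] //; [right|rewrite f00 eqxx in f0].
Qed.

Variables (c : nat -> nat) (g : nat -> nat -> S).
Hypothesis g_in : forall n b, (b < c n)%N -> order_ge n (g n b).
Hypothesis g_span : forall n f, order_ge n f ->
  exists q : nat -> S, order_ge n.+1 (f - \sum_(b < c n) q b * g n b).
Hypothesis g_indep : forall n (q : nat -> S), order_ge n.+1 (\sum_(b < c n) q b * g n b) ->
  forall b, (b < c n)%N -> rho (q b) = 0.

Lemma loc_gen_in n b : (b < c n)%N -> toR (g n b) \in I n.
Proof. by move=> bc; apply/valuation_ideal_order_ge/g_in. Qed.

Lemma loc_gen_span n (r : R) : r \in I n ->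
  exists s : nat -> R, r - \sum_(b < c n) s b * toR (g n b) \in I n.+1.
Proof.
have [f [h [h0 rE]]] := loc_frac r; have hu := to_loc_unit h0 => rI.
have fI : toR f \in I n.
  by have -> : toR f = toR h * r; [rewrite rE mulrC divrK|apply: valuation_idealM].
have [q qP] := g_span ((valuation_ideal_order_ge _ _).1 fI).
exists (fun b => (toR h)^-1 * toR (q b)).
have -> : r - \sum_(b < c n) (toR h)^-1 * toR (q b) * toR (g n b) =
  (toR h)^-1 * toR (f - \sum_(b < c n) q b * g n b).
  rewrite rmorphB mulrBr; congr (_ - _); first by rewrite rE mulrC.
  rewrite rmorph_sum mulr_sumr; apply: eq_bigr => i _.
  by rewrite rmorphM mulrA.
by apply: valuation_idealM; apply/valuation_ideal_order_ge.
Qed.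

Lemma loc_gen_indep n (r : nat -> R) : \sum_(b < c n) r b * toR (g n b) \in I n.+1 ->
  forall b, (b < c n)%N -> r b \in loc_max rho.
Proof.
move=> rI b bc; have [f [h [h0 fE]]] := loc_common_denom r (c n).
have : toR (\sum_(b < c n) f b * g n b) \in I n.+1.
  have -> : toR (\sum_(b < c n) f b * g n b) = toR h * (\sum_(b < c n) r b * toR (g n b)).
    rewrite rmorph_sum mulr_sumr; apply: eq_bigr => i _.
    by rewrite rmorphM /= -(fE i (ltn_ord i)) mulrA; congr (_ * _); apply: mulrC.
  exact: valuation_idealM.
move/valuation_ideal_order_ge/g_indep/(_ b bc) => fb0.
move/eqP: fb0; rewrite -(loc_ker_mul (fun _ => id) h0 (fE b bc)); apply.
Qed.
End LocValuation.

Section LocLengths.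
Variables (S A : idomainType) (rho : {rmorphism S -> A}) (w : S -> int) (t : S).
Hypothesis wo : is_order w.
Hypothesis wpos : forall f, f != 0 -> 0 <= w f /\ (0 < w f) = (rho f == 0).
Hypothesis t0 : t != 0.
Hypothesis wt : w t = 1.
Variables (c : nat -> nat) (g : nat -> nat -> S).
Hypothesis g_in : forall n b, (b < c n)%N -> order_ge w n (g n b).
Hypothesis g_span : forall n f, order_ge w n f ->
  exists q : nat -> S, order_ge w n.+1 (f - \sum_(b < c n) q b * g n b).
Hypothesis g_indep : forall n (q : nat -> S), order_ge w n.+1 (\sum_(b < c n) q b * g n b) ->
  forall b, (b < c n)%N -> rho (q b) = 0.

Lemma loc_valuation_lengths :
  exists (nu : discrete_valuation {fraction (loc rho)}) (dom : dominates nu (loc_max rho)),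
  (forall n, has_length (quotient_module (valuation_ideal dom n)) (\sum_(i < n) c i)) /\
  (forall n, has_length (subquotient (valuation_ideal dom n) (valuation_ideal dom n.+1)) (c n)).
Proof.
exists (loc_valuation rho wo t0 wt), (loc_valuation_dominates wo wpos t0 wt).
pose I n : submodClosed (loc rho)^o := valuation_ideal (loc_valuation_dominates wo wpos t0 wt) n.
have m1 : (1 : loc rho) \notin loc_max rho.
  by have [[_ ? _] _] := @loc_ker_prime _ _ rho _ rho (fun _ => id).
have gin n b : (b < c n)%N -> to_loc rho (g n b) \in I n.
  exact: (@loc_gen_in _ _ _ _ _ wo wpos t0 wt c g g_in n b).
have gsp n r := @loc_gen_span _ _ _ _ _ wo wpos t0 wt c g g_span n r.
have gindep n r := @loc_gen_indep _ _ _ _ _ wo wpos t0 wt c g g_indep n r.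
have full := valuation_ideal_full wo wpos t0 wt.
have leq i n r := @valuation_ideal_leq _ _ _ _ _ wo wpos t0 wt i n r.
have max n a u := @valuation_ideal_maxM _ _ _ _ _ wo wpos t0 wt n a u.
split=> n.
  exact: (@quotient_length (loc rho) (loc_max rho) I (@loc_max_unit _ _ rho) m1 full leq max
    c (fun n b => to_loc rho (g n b)) gin gsp gindep n).
exact: (@subquotient_length (loc rho) (loc_max rho) I (@loc_max_unit _ _ rho) m1 max
    c (fun n b => to_loc rho (g n b)) gin gsp gindep n).
Qed.
End LocLengths.

(** * Key polynomials *)

Section Bits.
Local Open Scope nat_scope.

Definition bit (b i : nat) : bool := odd (b %/ 2 ^ i).

Lemma bit_ge b i N : b < 2 ^ N -> N <= i -> bit b i = false.
Proof.
by move=> bN Ni; rewrite /bit divn_small // (leq_trans bN) // leq_pexp2l.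
Qed.

(** Products and sums over the bits of [b] are defined with the range i < b, sufficient because b <
    2^b; this passes to any range that contains all nonzero bits. *)
Lemma big_bit (R : Type) (idx : R) (op : Monoid.law idx) (F : nat -> R) b N :
  b < 2 ^ N -> (forall i, bit b i = false -> F i = idx) ->
  \big[op/idx]_(i < b) F i = \big[op/idx]_(i < N) F i.
Proof.
move=> bN F0; have bb : b < 2 ^ b by apply: ltn_expl.
have H M n : M <= n -> b < 2 ^ M ->
    \big[op/idx]_(i < n) F i = \big[op/idx]_(i < M) F i.
  move=> Mn bM; rewrite -!(big_mkord xpredT) (big_cat_nat (n := M)) //=.
  rewrite [X in op _ X]big_nat_cond [X in op _ X]big1 ?Monoid.mulm1 // => i.
  by rewrite andbT => /andP[Mi _]; apply/F0/(bit_ge bM).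
by case: (leqP b N) => [/H -> //|/ltnW /H ->].
Qed.

Lemma sum_bit b N : \sum_(i < N) bit b i * 2 ^ i = b %% 2 ^ N.
Proof.
elim: N => [|N IH]; first by rewrite big_ord0 expn0 modn1.
rewrite big_ord_recr /= IH /bit -modn2 expnS mulnC.
rewrite [RHS](divn_eq _ (2 ^ N)) modn_dvdm ?dvdn_mull // addnC; congr (_ + _).
by rewrite modn_divl mulnC.
Qed.

(** The binary fraction with digits b_i after the point, multiplied by 2^N: the exponent of the
    residue of P^b when z^(1/2^N) is the parameter. *)
Definition rev_bits N b := \sum_(i < N) bit b i * 2 ^ (N - i.+1).

Lemma rev_bitsS N b : rev_bits N.+1 b = (rev_bits N b).*2 + bit b N.
Proof.
rewrite /rev_bits big_ord_recr /= subnn muln1 -muln2 big_distrl /=.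
by congr (_ + _); apply: eq_bigr => i _; rewrite subSS -mulnA -expnSr subnSK.
Qed.

Lemma rev_bits_lt N b : rev_bits N b < 2 ^ N.
Proof.
elim: N => [|N IH]; first by rewrite /rev_bits big_ord0.
by rewrite rev_bitsS expnS; case: (bit b N); move: IH; rewrite -mul2n; lia.
Qed.

(** The parity of [rev_bits] gives the highest bit, and halving removes it. *)
Lemma rev_bits_inj N b b' : b < 2 ^ N -> b' < 2 ^ N ->
  rev_bits N b = rev_bits N b' -> b = b'.
Proof.
move=> bN b'N E; suff H i : i < N -> bit b i = bit b' i.
  rewrite -(modn_small bN) -(modn_small b'N) -!sum_bit.
  by apply: eq_bigr => i _; rewrite H.
elim: N {bN b'N} E i => // N IH; rewrite !rev_bitsS => E i.
have Eb : bit b N = bit b' N.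
  by have := congr1 odd E; rewrite !oddD !odd_double !oddb.
rewrite ltnS leq_eqVlt => /orP [/eqP -> //|]; apply: IH; move: E.
by rewrite Eb => /addIn /double_inj.
Qed.
End Bits.

Section EvaluationMorphism.
Variables (R R' : comNzRingType) (g : {rmorphism R -> R'}) (t : R').

Definition ev : {poly R} -> R' := horner_eval t \o map_poly g.
HB.instance Definition _ := GRing.RMorphism.on ev.

Lemma evC c : ev c%:P = g c.
Proof. by rewrite /ev /= /horner_eval map_polyC hornerC. Qed.

Lemma evX : ev 'X = t.
Proof. by rewrite /ev /= /horner_eval map_polyX hornerX. Qed.
End EvaluationMorphism.

(** * The x-adic order on polynomials *)

Section XDivisibility.
Variable C : idomainType.
Implicit Types p q : {poly C}.

Definition xdvd n p : Prop := exists q, p = 'X^n * q.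

Lemma xdvdP n p : xdvd n p <-> forall i, (i < n)%N -> p`_i = 0.
Proof.
split=> [[q ->] i i_n|H]; first by rewrite coefXnM i_n.
exists (\poly_(i < size p) p`_(n + i)); apply/polyP => i; rewrite coefXnM.
case: ltnP => [/H //|ni]; rewrite coef_poly subnKC //.
case: ltnP => // pi; apply: nth_default; apply: leq_trans pi _; exact: leq_subr.
Qed.

Lemma xdvd0 n : xdvd n 0. Proof. by exists 0; rewrite mulr0. Qed.

Lemma xdvdD n p q : xdvd n p -> xdvd n q -> xdvd n (p + q).
Proof. by move=> [u ->] [w ->]; exists (u + w); rewrite mulrDr. Qed.

Lemma xdvdMl n p q : xdvd n q -> xdvd n (p * q).
Proof. by move=> [u ->]; exists (p * u); rewrite mulrCA. Qed.

Lemma xdvd_leq m n p : (m <= n)%N -> xdvd n p -> xdvd m p.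
Proof. by move=> mn [u ->]; exists ('X^(n - m) * u); rewrite mulrA -exprD subnKC. Qed.

Lemma xdvdXM a n p : xdvd (a + n) ('X^a * p) <-> xdvd n p.
Proof.
split=> [[q E]|[q ->]]; exists q; last by rewrite exprD mulrA.
by apply: (mulfI (monic_neq0 (monicXn C a))); rewrite E exprD mulrA.
Qed.

Lemma xdvd1 p : xdvd 1 p <-> p.[0] = 0.
Proof.
rewrite horner_coef0; split=> [/xdvdP -> //|p0]; apply/xdvdP => i.
by rewrite ltnS leqn0 => /eqP ->.
Qed.

Definition xord p : nat := find (fun a => a != 0) p.

Lemma xordP n p : p != 0 -> (n <= xord p)%N <-> xdvd n p.
Proof.
move=> p0; split=> [n_le|/xdvdP H].
  apply/xdvdP => i i_n; apply/eqP/negPn; apply/negP.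
  by have /(before_find 0)/= -> : (i < xord p)%N by apply: leq_trans n_le.
rewrite leqNgt; apply/negP => /H /eqP; apply/negP; apply: (@nth_find _ 0 (fun a => a != 0)).
apply/hasP; exists (lead_coef p); last by rewrite lead_coef_eq0.
by rewrite lead_coefE mem_nth // prednK // size_poly_gt0.
Qed.

Lemma xord_decomp p : p != 0 -> exists q, p = 'X^(xord p) * q /\ q.[0] != 0.
Proof.
move=> p0; have [q pE] := (xordP (xord p) p0).1 (leqnn _).
exists q; split=> //; apply/eqP => /xdvd1 q0.
have H : xdvd (xord p + 1) p by rewrite {2}pE; apply/xdvdXM.
by have := (xordP _ p0).2 H; rewrite addn1 ltnn.
Qed.

Lemma xord_eq p n q : p = 'X^n * q -> q.[0] != 0 -> xord p = n.
Proof.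
move=> pE q0; have qn0 : q != 0 by apply: contraNneq q0 => ->; rewrite horner0.
have p0 : p != 0 by rewrite pE mulf_neq0 // -size_poly_eq0 size_polyXn.
apply/eqP; rewrite eqn_leq; apply/andP; split; last by apply/xordP => //; exists q.
rewrite leqNgt; apply/negP => /(xordP _ p0); rewrite pE -addn1.
by move/xdvdXM/xdvd1 => /eqP; apply/negP.
Qed.

Lemma xordM p q : p != 0 -> q != 0 -> xord (p * q) = (xord p + xord q)%N.
Proof.
move=> /xord_decomp [p' [pE p0]] /xord_decomp [q' [qE q0]].
apply: (@xord_eq _ _ (p' * q')); last by rewrite hornerM mulf_neq0.
by rewrite {1}pE {1}qE exprD mulrACA.
Qed.
End XDivisibility.

Lemma monic_basis_expansion (D : comNzRingType) (Q : nat -> {poly D}) :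
  (forall b, Q b \is monic) -> (forall b, size (Q b) = b.+1) ->
  forall M (f : {poly D}), (size f <= M)%N ->
  exists c : nat -> D, f = \sum_(b < M) (c b)%:P * Q b.
Proof.
move=> Qm Qs; elim=> [|M IH] f fM.
  by exists (fun=> 0); rewrite big_ord0; apply/eqP; rewrite -size_poly_leq0.
have [|c cE] := IH (f - (f`_M)%:P * Q M).
  apply/leq_sizeP => j Mj; rewrite coefB coefCM.
  move: Mj; rewrite leq_eqVlt => /orP [/eqP <-|Mj].
    have := Qm M; rewrite monicE lead_coefE Qs /= => /eqP ->.
    by rewrite mulr1 subrr.
  rewrite (nth_default _ (leq_trans fM Mj)) (@nth_default _ _ (Q M)) ?Qs //.
  by rewrite mulr0 subr0.
exists (fun b => if (b < M)%N then c b else f`_M).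
rewrite big_ord_recr /= ltnn; under eq_bigr do rewrite ltn_ord.
by rewrite -cE subrK.
Qed.

Section KeyPolynomials.
Variable k : fieldType.
Local Notation D := {poly {poly k}}.
Local Notation S := {poly D}.
Variable v : nat -> nat.
Hypothesis vS : forall i, (2 * v i < v i.+1)%N.

Definition pred_v (j : nat) := if j is i.+1 then v i else 0%N.
(** The exponent of x in the relation between u_(i-1), u_i and u_(i+1), positive by [vS]. *)
Definition delta (i : nat) := (v i.+1 - 2 * v i)%N.

Lemma pred_v_le j : (pred_v j <= 2 * v j)%N.
Proof. by case: j => //= j; have := vS j; lia. Qed.

(* Indices are shifted by one from the header: [key_poly j.+1] is P_j, and [key_poly 0] is z.
   In [S] the variables are z (innermost), x and y (outermost). *)
Fixpoint key_pair (j : nat) : S * S :=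
  if j is i.+1 then
    let: (p, q) := key_pair i in
    (q, q ^+ 2 - ('X^(2 * v i - pred_v i))%:P * p)
  else ('X%:P%:P, 'X).
Definition key_poly j := (key_pair j).1.

Lemma key_pair2 j : (key_pair j).2 = key_poly j.+1.
Proof. by rewrite /key_poly /=; case: (key_pair j). Qed.

Lemma key_polySS j : key_poly j.+2 =
  key_poly j.+1 ^+ 2 - ('X^(2 * v j - pred_v j))%:P * key_poly j.
Proof. by rewrite -key_pair2 /= -key_pair2 /key_poly; case: (key_pair j). Qed.

(** The third clause, a mere bound because [key_poly 0] is the constant z, ensures that the term
    subtracted in the recursion does not affect the leading one. *)
Lemma key_poly_monic j : [/\ key_poly j.+1 \is monic, size (key_poly j.+1) = (2 ^ j).+1
  & (size (key_poly j) <= 2 ^ j)%N].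
Proof.
elim: j => [|j [m s s']].
  by rewrite expn0 /key_poly /= monicX size_polyX size_polyC polyC_eq0 polyX_eq0.
have sq : size (key_poly j.+1 ^+ 2) = (2 ^ j.+1).+1.
  by rewrite expr2 size_Mmonic ?monic_neq0 // s expnS; lia.
have lt : (size (- (('X^(2 * v j - pred_v j))%:P * key_poly j)) < size (key_poly j.+1 ^+ 2))%N.
  rewrite sq size_polyN mul_polyC (leq_ltn_trans (size_scale_leq _ _)) //.
  by rewrite ltnS (leq_trans s') // leq_pexp2l.
split.
- by rewrite key_polySS monicE lead_coefDl // -monicE rpredX.
- by rewrite key_polySS size_polyDl.
- by rewrite s expnS; have := expn_gt0 2 j; lia.
Qed.

Definition key_basis (b : nat) : S := \prod_(i < b) key_poly i.+1 ^+ bit b i.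
Definition key_value (b : nat) : nat := (\sum_(i < b) bit b i * v i)%N.

Lemma key_basisE b N : (b < 2 ^ N)%N -> key_basis b = \prod_(i < N) key_poly i.+1 ^+ bit b i.
Proof.
move=> bN; apply: (@big_bit S 1 *%R (fun i => key_poly i.+1 ^+ bit b i)) => // i ->.
by rewrite expr0.
Qed.

Lemma key_valueE b N : (b < 2 ^ N)%N -> key_value b = (\sum_(i < N) bit b i * v i)%N.
Proof.
by move=> bN; apply: (@big_bit nat 0%N addn (fun i => bit b i * v i)%N) => // i ->.
Qed.

Lemma key_basis_monic b : key_basis b \is monic.
Proof. by apply: monic_prod => i _; rewrite rpredX //; have [] := key_poly_monic i. Qed.

Lemma size_key_basis b : size (key_basis b) = b.+1.
Proof.
have bb : (b < 2 ^ b)%N by apply: ltn_expl.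
rewrite -[X in _ = X.+1](modn_small bb) -sum_bit /key_basis.
suff H n : size (\prod_(i < n) key_poly i.+1 ^+ bit b i) =
  (\sum_(i < n) bit b i * 2 ^ i).+1%N by exact: H.
elim: n => [|n IH]; first by rewrite !big_ord0 size_poly1.
rewrite !big_ord_recr /=; have [m s _] := key_poly_monic n.
have pm : \prod_(i < n) key_poly i.+1 ^+ bit b i \is monic.
  by apply: monic_prod => i _; rewrite rpredX //; have [] := key_poly_monic i.
rewrite size_Mmonic ?monic_neq0 ?rpredX // IH.
case: (bit b n); rewrite ?expr1 ?expr0 ?s ?size_poly1 ?mul1n ?mul0n ?addn0 ?addnS //.
by rewrite addn0.
Qed.

(* [tr m] is u_(N-m), computed from u_N = 0 and from a variable (the inner one of [D]) for
   u_(N-1); the outer variable of [D] is x.  Setting u_N = 0 does not change the x-adic order of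
   polynomials of y-degree less than 2^N: this is what [trunc_expansion] shows. *)
Section Truncation.
Variable N : nat.

Fixpoint tr_pair (m : nat) : D * D :=
  if m is i.+1 then
    let: (p, q) := tr_pair i in (q, q ^+ 2 - 'X^(delta (N - i.+1)) * p)
  else (0, 'X%:P).
Definition tr m := (tr_pair m).1.

Lemma tr_pair2 m : (tr_pair m).2 = tr m.+1.
Proof. by rewrite /tr /=; case: (tr_pair m). Qed.

Lemma trSS m : tr m.+2 = tr m.+1 ^+ 2 - 'X^(delta (N - m.+1)) * tr m.
Proof. by rewrite -tr_pair2 /= -tr_pair2 /tr; case: (tr_pair m). Qed.

(** At x = 0 the positive exponent [delta] removes the second term of the recursion, and each step
    is a squaring. *)
Lemma tr_residue m : (tr m.+1).[0] = 'X^(2 ^ m).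
Proof.
elim: m => [|m IH]; first by rewrite /tr /= hornerC.
have d0 : (delta (N - m.+1) == 0%N) = false.
  by apply/negbTE; rewrite -lt0n subn_gt0.
by rewrite trSS hornerD hornerN horner_exp hornerM IH hornerXn expr0n d0 mul0r subr0 -exprM expnSr.
Qed.

Definition tr_const : {rmorphism k -> D} := (polyC : {rmorphism _ -> D}) \o (polyC : {rmorphism k -> _}).
(** [tr_base] and [trunc] substitute u_(-1) for z and x^(v_0) u_0 for y, and fix x. *)
Definition tr_base : {rmorphism D -> D} := ev (ev tr_const (tr N.+1)) 'X.
Definition trunc : {rmorphism S -> D} := ev tr_base ('X^(v 0) * tr N).

Lemma truncC d : trunc d%:P = tr_base d. Proof. exact: evC. Qed.
Lemma truncX : trunc 'X = 'X^(v 0) * tr N. Proof. exact: evX. Qed.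
Lemma tr_baseX : tr_base 'X = 'X. Proof. exact: evX. Qed.
Lemma tr_baseC a : tr_base a%:P = ev tr_const (tr N.+1) a. Proof. exact: evC. Qed.

(** This is P_(j-1) = x^(v_(j-1)) u_(j-1): after x^(2 v_i) is factored out, the recursion of the P_i
    leaves u_i^2 - u_(i-1), which is x^(delta i) u_(i+1). *)
Lemma trunc_key j : (j <= N.+1)%N -> trunc (key_poly j) = 'X^(pred_v j) * tr (N.+1 - j).
Proof.
suff H i : ((i <= N.+1)%N -> trunc (key_poly i) = 'X^(pred_v i) * tr (N.+1 - i)) /\
  ((i <= N)%N -> trunc (key_poly i.+1) = 'X^(v i) * tr (N - i)) by move/(H j).1.
elim: i => [|i [IH1 IH2]].
  split=> _; rewrite /key_poly /=.
    by rewrite truncC tr_baseC evX expr0 mul1r subn0.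
  by rewrite truncX subn0.
split=> iN; first exact: IH2.
rewrite key_polySS rmorphB rmorphXn rmorphM IH2 1?ltnW // IH1 1?ltnW 1?ltnW //.
have -> : trunc ('X^(2 * v i - pred_v i))%:P = 'X^(2 * v i - pred_v i).
  by rewrite truncC rmorphXn /= tr_baseX.
rewrite mulrA -exprD subnK ?pred_v_le // exprMn -exprM mulnC -mulrBr.
have [m mE] : exists m, N = (i + m.+1)%N by exists (N - i.+1)%N; lia.
have -> : (N - i = m.+1)%N by lia.
have -> : (N.+1 - i = m.+2)%N by lia.
have -> : (N - i.+1 = m)%N by lia.
rewrite trSS; have -> : (N - m.+1 = i)%N by lia.
rewrite opprB addrCA subrr addr0 mulrA -exprD; congr ('X^_ * _).
by rewrite /delta; have := vS i; lia.
Qed.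

Definition tr_basis b : D := \prod_(i < N) tr (N - i) ^+ bit b i.

Lemma trunc_basis b : (b < 2 ^ N)%N -> trunc (key_basis b) = 'X^(key_value b) * tr_basis b.
Proof.
move=> bN; rewrite (key_basisE bN) (key_valueE bN) rmorph_prod /tr_basis expr_sum.
rewrite -big_split /=; apply: eq_bigr => i _.
by rewrite rmorphXn trunc_key ?ltnS 1?ltnW // subSS exprMn -exprM mulnC.
Qed.

Lemma tr_basis_residue b : (tr_basis b).[0] = 'X^(rev_bits N b).
Proof.
rewrite /tr_basis horner_prod /rev_bits expr_sum; apply: eq_bigr => i _.
rewrite horner_exp -[(N - i)%N](@prednK) ?subn_gt0 // tr_residue -exprM mulnC.
by rewrite subnS.
Qed.

Lemma tr_base_residue d : (tr_base d).[0] = d.[0] \Po 'X^(2 ^ N).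
Proof.
elim/poly_ind: d => [|d c _]; first by rewrite rmorph0 !horner0 comp_poly0.
rewrite rmorphD rmorphM /= tr_baseX tr_baseC hornerD hornerMX mulr0 add0r.
rewrite hornerMXaddC mulr0 add0r.
elim/poly_ind: c => [|c a IHc]; first by rewrite rmorph0 horner0 comp_poly0.
rewrite rmorphD rmorphM /= evX evC hornerD hornerM IHc tr_residue /= hornerC.
by rewrite comp_poly_MXaddC.
Qed.

(** The exponents [rev_bits N b] are distinct modulo 2^N, so the coefficient at j 2^N +
    [rev_bits N b] isolates the j-th coefficient of [c b]. *)
Lemma comp_Xn_independent M (c : nat -> {poly k}) : (M <= 2 ^ N)%N ->
  \sum_(b < M) (c b \Po 'X^(2 ^ N)) * 'X^(rev_bits N b) = 0 ->
  forall b, (b < M)%N -> c b = 0.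
Proof.
move=> MN sum0 b bM; apply/polyP => j; rewrite coef0.
have N0 : (0 < 2 ^ N)%N by rewrite expn_gt0.
have := congr1 (fun p : {poly k} => p`_(j * 2 ^ N + rev_bits N b)) sum0.
rewrite coef0 coef_sum (bigD1 (Ordinal bM)) //= big1 => [|i /eqP ib].
  rewrite addr0 coefMXn ltnNge leq_addl /= addnK coef_comp_poly_Xn //.
  by rewrite dvdn_mull // mulnK.
rewrite coefMXn; case: ltnP => // le; rewrite coef_comp_poly_Xn //.
case: ifP => // /dvdnP [q qE]; case: ib; apply: val_inj => /=.
apply: (@rev_bits_inj N); rewrite ?(leq_trans _ MN) //.
have : (j * 2 ^ N + rev_bits N b = q * 2 ^ N + rev_bits N i)%N by rewrite -qE subnK.
by move/(congr1 (modn^~ (2 ^ N)%N)); rewrite !modnMDl !modn_small ?rev_bits_lt.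
Qed.

(** The terms cannot cancel. If all are divisible by x^n and their sum by x^(n+1), division by x^n
    and x = 0 give a relation as in [comp_Xn_independent], so each term is divisible by x^(n+1). The
    right-hand side does not involve N, whence the order is independent of the level. *)
Lemma trunc_expansion M (c : nat -> D) n : (M <= 2 ^ N)%N ->
  xdvd n (trunc (\sum_(b < M) (c b)%:P * key_basis b)) <->
  (forall b, (b < M)%N -> xdvd n ('X^(key_value b) * c b)).
Proof.
move=> MN; have bN b : (b < M)%N -> (b < 2 ^ N)%N by move/leq_trans; apply.
have truncE : trunc (\sum_(b < M) (c b)%:P * key_basis b) =
  \sum_(b < M) tr_base ('X^(key_value b) * c b) * tr_basis b.
  rewrite rmorph_sum; apply: eq_bigr => b _; rewrite rmorphM trunc_basis ?bN //.
  by rewrite truncC rmorphM rmorphXn /= tr_baseX mulrA [_ * 'X^_]mulrC.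
rewrite truncE {truncE}; have xn_base d m : xdvd m d -> xdvd m (tr_base d).
  by move=> [q ->]; rewrite rmorphM rmorphXn /= tr_baseX; exists (tr_base q).
split=> [|H]; last first.
  elim/big_rec: _ => [|b p _]; first exact: xdvd0.
  by apply: xdvdD; rewrite mulrC; apply: xdvdMl; apply/xn_base/H.
elim: n => [_ b _|n IH H b bM]; first by exists ('X^(key_value b) * c b); rewrite expr0 mul1r.
have {}IH := IH (xdvd_leq (leqnSn _) H).
have /choice [d dE] : forall b, exists d, (b < M)%N -> 'X^(key_value b) * c b = 'X^n * d.
  move=> b'; case: (ltnP b' M) => [/IH [q ->]|_]; last by exists 0.
  by exists q.
rewrite dE //; rewrite -addn1; apply/xdvdXM/xdvd1.
apply: (@comp_Xn_independent M (fun b => (d b).[0])) => //.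
have : xdvd (n + 1) ('X^n * \sum_(b < M) tr_base (d b) * tr_basis b).
  rewrite addn1; move: H; rewrite mulr_sumr.
  rewrite (eq_bigr (fun b : 'I_M => 'X^n * (tr_base (d b) * tr_basis b))) //.
  move=> i _; by rewrite dE // rmorphM rmorphXn /= tr_baseX mulrA.
move/xdvdXM/xdvd1; rewrite horner_sum => E; rewrite -[RHS]E; apply: eq_bigr => i _.
by rewrite hornerM tr_basis_residue tr_base_residue.
Qed.
End Truncation.
End KeyPolynomials.

(** * The valuation on k[z,x,y] and bases of its graded pieces *)

Section Valuation.
Variable k : fieldType.
Local Notation A := {poly k}.
Local Notation D := {poly A}.
Local Notation S := {poly D}.
Variable v : nat -> nat.
Hypothesis v0 : (0 < v 0)%N.
Hypothesis vS : forall i, (2 * v i < v i.+1)%N.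
Local Notation trunc N := (trunc k v N).
Local Notation Q := (key_basis k v).
Local Notation vQ := (key_value v).

Definition origin : {rmorphism S -> A} := horner_eval (0 : A) \o horner_eval (0 : D).

Lemma originE f : origin f = f.[0].[0]. Proof. by []. Qed.

Lemma expansion M (f : S) : (size f <= M)%N -> exists c : nat -> D, f = \sum_(b < M) (c b)%:P * Q b.
Proof.
by apply: monic_basis_expansion => b; [apply: key_basis_monic|apply: size_key_basis].
Qed.

Lemma trunc_xdvd (f : S) n N N' : (size f <= 2 ^ N)%N -> (size f <= 2 ^ N')%N ->
  xdvd n (trunc N f) -> xdvd n (trunc N' f).
Proof.
move=> fN fN'; have [c ->] := expansion (leqnn (size f)).
by move=> /(trunc_expansion vS _ _ fN) H; apply/(trunc_expansion vS _ _ fN').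
Qed.

(** A zero image is divisible by every power of x, and by [trunc_expansion] so is every coefficient
    of the expansion of [f]. *)
Lemma trunc_neq0 (f : S) N : f != 0 -> (size f <= 2 ^ N)%N -> trunc N f != 0.
Proof.
move=> f0 fN; apply: contra_neq f0 => tf0; have [c] := expansion (leqnn (size f)).
move: (size f) fN => M MN fE; rewrite fE big1 // => b _; suff -> : c b = 0 by rewrite mul0r.
apply/polyP => i; rewrite coef0.
have : xdvd (vQ b + i.+1) (trunc N f) by rewrite tf0; apply: xdvd0.
rewrite fE => /(trunc_expansion vS _ _ MN)/(_ b (ltn_ord b))/xdvdXM/xdvdP.
by apply.
Qed.

(** The level [size f] is merely a canonical one that is high enough; [pord_trunc] allows any
    other. *)
Definition pord (f : S) : nat := xord (trunc (size f) f).

Lemma size_le_exp (f : S) : (size f <= 2 ^ size f)%N.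
Proof. by apply: ltnW; apply: ltn_expl. Qed.

Lemma pordP n (f : S) N : f != 0 -> (size f <= 2 ^ N)%N -> (n <= pord f)%N <-> xdvd n (trunc N f).
Proof.
move=> f0 fN; have H := xordP n (trunc_neq0 f0 (size_le_exp f)).
split=> [/H|fn]; first exact: trunc_xdvd (size_le_exp f) fN.
by apply/H; apply: trunc_xdvd fN (size_le_exp f) fn.
Qed.

Lemma pord_trunc (f : S) N : f != 0 -> (size f <= 2 ^ N)%N -> pord f = xord (trunc N f).
Proof.
move=> f0 fN; have H n := xordP n (trunc_neq0 f0 fN).
apply/eqP; rewrite eqn_leq; apply/andP; split.
  by apply/H/(pordP _ f0 fN).
by apply/(pordP _ f0 fN)/H.
Qed.

Definition sord (f : S) : int := (pord f)%:Z.

(** At a level high enough for the polynomials involved, [sord] is the x-adic order pulled back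
    along the ring morphism [trunc N]. *)
Lemma sord_is_order : is_order sord.
Proof.
have big (s : seq S) : exists N, forall f : S, f \in s -> (size f <= 2 ^ N)%N.
  elim: s => [|f s [N NP]]; first by exists 0%N.
  exists (maxn (size f) N) => g; rewrite in_cons => /orP [/eqP ->|gs].
    by apply: leq_trans (size_le_exp f) _; rewrite leq_pexp2l // leq_maxl.
  by apply: leq_trans (NP _ gs) _; rewrite leq_pexp2l // leq_maxr.
split=> f g f0 g0.
  have [N NP] := big [:: f; g; f * g].
  rewrite /sord !(@pord_trunc _ N) ?mulf_neq0 ?NP ?inE ?eqxx ?orbT //.
  rewrite rmorphM xordM ?PoszD //; apply: trunc_neq0; rewrite ?NP ?inE ?eqxx ?orbT //.
move=> s0; have [N NP] := big [:: f; g; f + g].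
suff : (minn (pord f) (pord g) <= pord (f + g))%N.
  by rewrite /sord geq_min => /orP [] le; rewrite ge_min !lez_nat le ?orbT.
apply/(@pordP _ _ N); rewrite ?NP ?inE ?eqxx ?orbT // rmorphD.
by apply: xdvdD; apply/(@pordP _ _ N); rewrite ?NP ?inE ?eqxx ?orbT // ?geq_minl ?geq_minr.
Qed.

(** At x = 0 the image of y vanishes, as v_0 > 0, and z becomes the 2^N-th power of the parameter.
    Hence positive order means vanishing at x = y = 0. *)
Lemma trunc_origin (f : S) N : (trunc N f).[0] = origin f \Po 'X^(2 ^ N).
Proof.
rewrite originE; elim/poly_ind: f => [|f d _]; first by rewrite rmorph0 !horner0 comp_poly0.
rewrite rmorphD rmorphM /= truncX truncC hornerD !hornerM hornerXn expr0n.
by rewrite -leqn0 leqNgt v0 /= mul0r mulr0 add0r tr_base_residue // hornerMXaddC mulr0 add0r.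
Qed.

Lemma pord_gt0 (f : S) : f != 0 -> (0 < pord f)%N = (origin f == 0).
Proof.
move=> f0; have := pordP 1 f0 (size_le_exp f); set N := size f.
have E : (xdvd 1 (trunc N f)) <-> origin f = 0.
  rewrite xdvd1 trunc_origin; split=> [H|->]; last by rewrite comp_poly0.
  apply/polyP => i; rewrite coef0; have := congr1 (fun p : A => p`_(i * 2 ^ N)) H.
  by rewrite coef_comp_poly_Xn ?expn_gt0 // dvdn_mull // mulnK ?expn_gt0 // coef0.
by move=> H; apply/idP/eqP => [/H /E|/E /H].
Qed.

Lemma pordX : pord 'X%:P = 1%N.
Proof.
by rewrite /pord truncC tr_baseX; apply: (@xord_eq _ _ _ 1); rewrite ?expr1 ?mulr1 // hornerC oner_neq0.
Qed.

Lemma polyXC_neq0 : ('X%:P : S) != 0. Proof. by rewrite polyC_eq0 polyX_eq0. Qed.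

Lemma sordX : sord 'X%:P = 1. Proof. by rewrite /sord pordX. Qed.

Lemma sord_origin (f : S) : f != 0 -> 0 <= sord f /\ (0 < sord f) = (origin f == 0).
Proof. by move=> f0; rewrite -(pord_gt0 f0). Qed.

Local Notation order_ge := (order_ge sord).

Lemma order_geP n (f : S) N : (size f <= 2 ^ N)%N -> order_ge n f <-> xdvd n (trunc N f).
Proof.
move=> fN; have [->|f0] := eqVneq f 0.
  by rewrite !rmorph0; split=> _; [apply: xdvd0|left].
by rewrite -(pordP n f0 fN); split=> [[f00|]|] //; [rewrite f00 eqxx in f0|right].
Qed.

Lemma order_geD n f h : order_ge n f -> order_ge n h -> order_ge n (f + h).
Proof.
pose N := maxn (size f) (size h).
have E : forall u : S, (size u <= N)%N -> (size u <= 2 ^ N)%N.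
  by move=> u uN; apply: leq_trans uN _; apply: ltnW; apply: ltn_expl.
move=> /(order_geP n (E _ (leq_maxl _ _))) fn /(order_geP n (E _ (leq_maxr _ _))) hn.
by apply/(order_geP n (E _ (size_polyD _ _))); rewrite rmorphD; apply: xdvdD.
Qed.

Lemma order_ge_max n a f : origin a = 0 -> order_ge n f -> order_ge n.+1 (a * f).
Proof.
move=> a0; have [->|an0] := eqVneq a 0; first by rewrite mul0r; left.
have [->|fn0] := eqVneq f 0; first by rewrite mulr0; left.
move=> [f0|nf]; first by rewrite f0 mulr0; left.
right; rewrite (sord_is_order.1 _ _ an0 fn0); have [_] := sord_origin an0.
by rewrite a0 eqxx; move: nf; move: (sord a) (sord f) => p q; clear; lia.
Qed.

Lemma size_expansion M (c : nat -> D) : (size (\sum_(b < M) (c b)%:P * Q b : S)%R <= 2 ^ M)%N.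
Proof.
apply: leq_trans (size_sum _ _ _) _; apply/bigmax_leqP => b _.
rewrite mul_polyC (leq_trans (size_scale_leq _ _)) // size_key_basis //.
by rewrite (leq_trans (ltn_ord b)) // ltnW // ltn_expl.
Qed.

Lemma order_ge_expansion n M (c : nat -> D) : order_ge n (\sum_(b < M) (c b)%:P * Q b) <->
  (forall b, (b < M)%N -> xdvd n ('X^(vQ b) * c b)).
Proof.
rewrite (order_geP _ (size_expansion M c)); apply: trunc_expansion => //.
by apply: ltnW; apply: ltn_expl.
Qed.

Variable c : nat -> nat.
Hypothesis cP : forall b n, (b < c n)%N = (vQ b <= n)%N.

Definition gen n b : S := ('X^(n - vQ b))%:P * Q b.

Lemma gen_in n b : (b < c n)%N -> order_ge n (gen n b).
Proof.
move=> bc; pose d i : D := if i == b then 'X^(n - vQ b) else 0.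
have -> : gen n b = \sum_(i < b.+1) (d i)%:P * Q i.
  rewrite big_ord_recr /= big1 ?add0r /d ?eqxx // => i _.
  by rewrite ltn_eqF ?mul0r.
apply/(@order_ge_expansion _ _ d) => i _; rewrite /d; case: eqP => [->|_]; last by rewrite mulr0; apply: xdvd0.
by rewrite -exprD subnKC -?cP //; exists 1; rewrite mulr1.
Qed.

(** In the expansion of [f], the terms with v(b) <= n are multiples of [gen n b], and those with
    v(b) > n have order above n whatever their coefficient. *)
Lemma gen_span n (f : S) : order_ge n f ->
  exists q : nat -> S, order_ge n.+1 (f - \sum_(b < c n) q b * gen n b).
Proof.
pose M := maxn (size f) (c n); have [d fE] := expansion (leq_maxl (size f) (c n)).
rewrite -/M in fE; rewrite {1}fE => /order_ge_expansion dP.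
have /choice [q qP] b : exists q, (b < c n)%N -> d b = 'X^(n - vQ b) * q.
  case: (ltnP b (c n)) => [bc|_]; last by exists 0.
  have [q] := dP b (leq_trans bc (leq_maxr _ _)); rewrite cP in bc.
  rewrite -{1}(subnKC bc) exprD -mulrA => /mulfI E; exists q => _; apply: E.
  by rewrite -size_poly_eq0 size_polyXn.
exists (fun b => (q b)%:P).
have -> : f - \sum_(b < c n) (q b)%:P * gen n b =
  \sum_(b < M) ((if (b < c n)%N then 0 else d b)%:P * Q b).
  rewrite (eq_bigr (fun b : 'I_(c n) => (d b)%:P * Q b)) => [|b _].
    rewrite (big_ord_widen M (fun b => (d b)%:P * Q b)) ?leq_maxr // {1}fE.
    rewrite [X in _ - X]big_mkcond -sumrB /=; apply: eq_bigr => i _.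
    by case: ifP; rewrite ?mul0r ?subrr ?subr0.
  by rewrite (qP b) // /gen mulrA -polyCM mulrC [q b * _]mulrC [RHS]mulrC.
apply/(@order_ge_expansion _ _ (fun b => if (b < c n)%N then 0 else d b)) => b bM; case: ifP => [_|]; first by rewrite mulr0; apply: xdvd0.
rewrite cP => /negbT; rewrite -ltnNge => nb.
by apply: (xdvd_leq nb); exists (d b).
Qed.

(** Replacing each [q b] by its value at x = y = 0 changes the sum only in order above n, and yields
    coefficients free of y, to which [order_ge_expansion] applies. *)
Lemma gen_indep n (q : nat -> S) : order_ge n.+1 (\sum_(b < c n) q b * gen n b) ->
  forall b, (b < c n)%N -> origin (q b) = 0.
Proof.
move=> qI; pose d b : D := (origin (q b))%:P * 'X^(n - vQ b).
have : order_ge n.+1 (\sum_(b < c n) (d b)%:P * Q b).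
  have -> : \sum_(b < c n) (d b)%:P * Q b = \sum_(b < c n) q b * gen n b +
      \sum_(b < c n) ((origin (q b))%:P%:P - q b) * gen n b.
    rewrite -big_split; apply: eq_bigr => b _ /=.
    by rewrite -mulrDl addrCA subrr addr0 /gen mulrA /d polyCM.
  apply: order_geD => //; elim/big_rec: _ => [|b w _ wI]; first by left.
  apply: order_geD => //; apply: order_ge_max; last exact: gen_in.
  by rewrite originE hornerD hornerN hornerC hornerD hornerN hornerC originE subrr.
move=> /(@order_ge_expansion _ _ d) H b bc; have := H b bc; rewrite /d mulrCA -exprD subnKC -?cP // mulrC -addn1.
by move=> /xdvdXM /xdvd1; rewrite hornerC.
Qed.
End Valuation.

(** * Krull dimension *)

Section KrullDimension.
Variable A : idomainType.
Local Notation D := {poly A}.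
Local Notation S := {poly D}.
Variable rho : {rmorphism S -> A}.
Hypothesis rhoE : forall f, rho f = f.[0].[0].
Local Notation R := (loc rho).
Local Notation toR := (to_loc rho).

Definition modx : {rmorphism S -> {poly A}} := map_poly (horner_eval (0 : A)).

Lemma coef_modx (f : S) i : (modx f)`_i = (f`_i).[0].
Proof. by rewrite coef_map. Qed.

Lemma rho_modx f : rho f = (modx f).[0].
Proof. by rewrite rhoE !horner_coef0 coef_modx horner_coef0. Qed.

Lemma modx_neq0 f : rho f != 0 -> modx f != 0.
Proof. by rewrite rho_modx; apply: contra_neq => ->; rewrite horner0. Qed.

Lemma modx_eq0 f : modx f = 0 -> exists f', f = 'X%:P * f'.
Proof.
move=> f0; have /choice [q qE] i : exists q, f`_i = 'X * q.
  by have /xdvd1 [q ->] : (f`_i).[0] = 0; [rewrite -coef_modx f0 coef0|exists q; rewrite expr1].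
exists (\poly_(i < size f) q i); apply/polyP => i; rewrite coefCM coef_poly.
by case: ltnP => [_|fi]; [rewrite qE|rewrite mulr0 nth_default].
Qed.

Lemma rho_eq0 f : rho f = 0 -> exists a b, f = 'X%:P * a + 'X * b.
Proof.
elim/poly_ind: f => [|f c _]; first by exists 0, 0; rewrite !mulr0 addr0.
rewrite rhoE hornerMXaddC mulr0 add0r => /xdvd1 [q ->].
by exists q%:P, f; rewrite expr1 polyCM addrC mulrC [f * _]mulrC [_ * 'X%:P]mulrC.
Qed.

Lemma x_decomp (f : S) : f != 0 -> exists n f', f = 'X%:P ^+ n * f' /\ modx f' != 0.
Proof.
(* Each division by x lowers the x-degree of the leading coefficient in y. *)
have [s] := ubnP (size (lead_coef f)); elim: s f => // s IH f fs f0.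
have [m0|m0] := eqVneq (modx f) 0; last by exists 0%N, f; rewrite expr0 mul1r.
have [f' fE] := modx_eq0 m0.
have f0' : f' != 0 by apply: contraNneq f0; rewrite fE => ->; rewrite mulr0.
have [|//|n [f'' [f'E m0']]] := IH f'.
  rewrite -ltnS; apply: leq_trans fs; rewrite ltnS fE lead_coefM lead_coefC.
  by rewrite mulrC size_mulX // lead_coef_eq0.
by exists n.+1, f''; rewrite fE f'E mulrA -exprS.
Qed.

(** Modulo x, [f] is y^r times a polynomial with nonzero constant term; [e] lifts the latter and
    becomes a unit of R. *)
Lemma y_decomp (f : S) : modx f != 0 ->
  exists r e h, f = 'X ^+ r * e + 'X%:P * h /\ rho e != 0.
Proof.
move=> /xord_decomp [q [fE q0]]; set r := xord _ in fE.
pose e : S := map_poly polyC q.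
have me : modx e = q.
  by apply/polyP => i; rewrite coef_modx coef_map hornerC.
have [|h hE] := @modx_eq0 (f - 'X^r * e).
  by rewrite rmorphB rmorphM rmorphXn /= map_polyX -/modx -[map_poly _ e]/(modx e) me -fE subrr.
exists r, e, h; rewrite -hE addrCA subrr addr0; split=> //.
by rewrite rho_modx me.
Qed.

Lemma loc_max_to_loc f : (toR f \in loc_max rho) = (rho f == 0).
Proof. exact: (loc_ker_to_loc (fun _ => id)). Qed.

Lemma loc_max_frac f g : rho g != 0 -> (toR f / toR g \in loc_max rho) = (rho f == 0).
Proof. exact: (loc_kerE (fun _ => id)). Qed.

Lemma proper_sub_max (J : {pred R}) : idealr_closed J -> {subset J <= loc_max rho}.
Proof.
move=> [J0 J1 Jlin] a aJ; apply: contraNT J1 => /loc_max_unit au.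
by rewrite -(mulVr au) -[_ * a]addr0; apply: Jlin.
Qed.

Section Prime.
Variable P : {pred R}.
Hypothesis Pp : prime_ideal P.

Let P0 : 0 \in P. Proof. by have [[]] := Pp. Qed.
Let P1 : 1 \notin P. Proof. by have [[]] := Pp. Qed.
Let Plin a u w : u \in P -> w \in P -> a * u + w \in P.
Proof. by have [[_ _ H] _] := Pp; apply: H. Qed.

Lemma primeM a u : u \in P -> a * u \in P.
Proof. by move=> uP; rewrite -[a * u]addr0; apply: Plin. Qed.

Lemma prime_sub u w : u \in P -> w \in P -> u - w \in P.
Proof. by move=> uP wP; rewrite addrC -mulN1r; apply: Plin. Qed.

Lemma prime_mul u w : u * w \in P -> u \in P \/ w \in P.
Proof. by have [_ H] := Pp => /H /orP. Qed.

Lemma prime_unit u : u \is a GRing.unit -> u \notin P.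
Proof. by move=> uu; apply: contra P1 => uP; rewrite -(mulVr uu); apply: primeM. Qed.

Lemma prime_exp u n : u ^+ n \in P -> u \in P.
Proof.
elim: n => [|n IH]; first by rewrite expr0 (negPf P1).
by rewrite exprS => /prime_mul [].
Qed.

Lemma prime_frac f g : rho g != 0 -> (toR f / toR g \in P) = (toR f \in P).
Proof.
move=> g0; apply/idP/idP => [|fP]; last by rewrite mulrC; apply: primeM.
by move/(primeM (toR g)); rewrite mulrC divrK ?to_loc_unit.
Qed.

Lemma prime_contains_max f : toR 'X%:P \in P -> modx f != 0 -> toR f \in P ->
  {subset loc_max rho <= P}.
Proof.
move=> xP /y_decomp [r [e [h [fE e0]]]] fP.
have yP : toR 'X \in P.
  have : toR ('X^r * e) \in P.
    have -> : toR ('X^r * e) = toR f - toR h * toR 'X%:P.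
      by rewrite -rmorphM -rmorphB fE [h * _]mulrC addrK.
    by apply: prime_sub => //; apply: primeM.
  rewrite rmorphM rmorphXn => /prime_mul [/prime_exp //|].
  by rewrite (negPf (prime_unit (to_loc_unit e0))).
move=> a; have [u [g [g0 ->]]] := loc_frac a; rewrite prime_frac //.
rewrite loc_max_frac // => /eqP/rho_eq0 [s [t ->]].
rewrite rmorphD !rmorphM /= mulrC; apply: Plin => //.
by rewrite mulrC; apply: primeM.
Qed.

(** In R, a nonzero [d] free of y is a power of x times a unit. A prime avoiding x can therefore be
    studied over the fraction field of A[x], where polynomials in y admit Euclidean division. *)
Lemma prime_base (d : D) : toR 'X%:P \notin P -> d != 0 -> toR d%:P \notin P.
Proof.
move=> xP /xord_decomp [q [-> q0]]; apply: contra xP.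
rewrite polyCM rmorphM polyC_exp rmorphXn => /prime_mul [/prime_exp //|].
by rewrite (negPf (prime_unit (to_loc_unit _))) // rhoE hornerC.
Qed.

Lemma min_size f : f != 0 -> toR f \in P -> exists f0, [/\ f0 != 0, toR f0 \in P &
  forall g, g != 0 -> toR g \in P -> (size f0 <= size g)%N].
Proof.
move=> f0 fP.
have ex : exists n, `[< exists g : S, [/\ g != 0, toR g \in P & size g = n] >].
  by exists (size f); apply/asboolP; exists f.
have [n /asboolP [g [g0 gP gn]] nmin] := ex_minnP ex; exists g; split=> // h h0 hP.
by rewrite gn; apply: nmin; apply/asboolP; exists h.
Qed.
End Prime.

(** If P' avoids x, both primes come from a principal ideal domain, where nonzero primes are
    incomparable: a contradiction. If P' contains x, it remains to find in P' an element not
    divisible by x: the numerator of [g] when x is in P, otherwise that of [p] stripped of its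
    powers of x. *)
Lemma height_two (P P' : {pred R}) p g : prime_ideal P -> prime_ideal P' ->
  {subset P <= P'} -> p \in P -> p != 0 -> g \in P' -> g \notin P ->
  {subset loc_max rho <= P'}.
Proof.
move=> Pp Pp' PP' pP p0 gP' gP.
have [fp [hp [hp0 pE]]] := loc_frac p; have [fg [hg [hg0 gE]]] := loc_frac g.
move: pP gP gP' p0; rewrite {}pE {}gE !prime_frac // => pP gP gP' p0.
have fp0 : fp != 0 by apply: contraNneq p0 => ->; rewrite rmorph0 mul0r.
have [xP'|xP'] := boolP (toR 'X%:P \in P'); last first.
  exfalso; have xP : toR 'X%:P \notin P by apply: contra xP'; apply: PP'.
  have [f0 [f00 f0P f0min]] := min_size fp0 (PP' _ pP).
  have divis u : toR u \in P' -> exists (d : D) q, d != 0 /\ d%:P * u = q * f0.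
    move=> uP; pose d := lead_coef f0 ^+ scalp u f0.
    have d0 : d != 0 by rewrite expf_neq0 // lead_coef_eq0.
    have E : d%:P * u = (u %/ f0) * f0 + u %% f0.
      by rewrite mul_polyC -Pdiv.WeakIdomain.divp_eq.
    exists d, (u %/ f0)%R; split=> //; rewrite E.
    suff -> : u %% f0 = 0 by rewrite addr0.
    apply/eqP/negPn/negP => r0; have := f0min _ r0.
    rewrite leqNgt ltn_modp f00 => /(_ _)/negP; apply=> //.
    have -> : toR (u %% f0) = toR d%:P * toR u - toR (u %/ f0) * toR f0.
      by rewrite -!rmorphM -rmorphB E addrAC subrr add0r.
    by apply: (prime_sub Pp'); apply: (primeM Pp').
  have [f0p|f0p] := boolP (toR f0 \in P).
    have [d [q [d0 E]]] := divis _ gP'.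
    have : toR (d%:P * fg) \in P by rewrite E rmorphM; apply: (primeM Pp).
    rewrite rmorphM => /(prime_mul Pp) [dP|]; last by apply/negP.
    by have /negP := prime_base Pp' xP' d0; apply; apply: PP'.
  have [f [fn0 fP fmin]] := min_size fp0 pP.
  have [d [q [d0 E]]] := divis _ (PP' _ fP).
  have : toR (q * f0) \in P by rewrite -E rmorphM; apply: (primeM Pp).
  rewrite rmorphM => /(prime_mul Pp) [qP|]; last by rewrite (negPf f0p).
  have q0 : q != 0.
    apply: contraNneq fn0 => q0; move/eqP: E; rewrite q0 mul0r mulf_eq0 polyC_eq0.
    by rewrite (negPf d0).
  have fq := fmin _ q0 qP; have := congr1 (fun u : S => size u) E.
  rewrite size_Cmul // size_mul // => sE.
  have q_gt0 : (0 < size q)%N by rewrite size_poly_gt0.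
  have f0_gt0 : (0 < size f0)%N by rewrite size_poly_gt0.
  (* As [q] is in P, it is at least as large as the minimal [f]; since d f = q f0, the factor [f0]
     has degree 0 in y, contrary to [prime_base]. *)
  have sf0 : size f0 == 1%N by move: sE fq q_gt0 f0_gt0; clear; lia.
  have [d' d'0 f0E] := size_poly1P _ sf0.
  by have /negP := prime_base Pp' xP' d'0; apply; rewrite -f0E.
have [xP|xP] := boolP (toR 'X%:P \in P).
  have m0 : modx fg != 0.
    apply: contraNneq gP => /modx_eq0 [f' ->].
    by rewrite rmorphM mulrC; apply: (primeM Pp).
  exact: (prime_contains_max Pp' xP' m0).
have [n [f' [fpE m0]]] := x_decomp fp0.
move: pP; rewrite fpE rmorphM rmorphXn => /(prime_mul Pp) [/(prime_exp Pp)|f'P].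
  by rewrite (negPf xP).
exact: (prime_contains_max Pp' xP' m0 (PP' _ f'P)).
Qed.

Lemma loc_krull_dim : has_krull_dim R 2.
Proof.
have id_rho g : rho g != 0 -> (idfun : {rmorphism S -> S}) g != 0.
  by move=> /rho_neq0; rewrite tofrac_eq0.
have rho_rho g : rho g != 0 -> rho g != 0 by [].
pose C i : {pred R} := if i is i'.+1 then if i' is 0 then loc_ker modx else loc_max rho
  else loc_ker (idfun : {rmorphism S -> S}).
split.
  exists C; split.
    case=> [|[|[|//]]] _ /=; first exact: (loc_ker_prime id_rho).
      exact: (loc_ker_prime modx_neq0).
    exact: (loc_ker_prime rho_rho).
  case=> [|[|//]] _ /=; split.
  - move=> a; have [f [g [g0 ->]]] := loc_frac a.
    rewrite (loc_kerE id_rho) // (loc_kerE modx_neq0) // => /eqP /= ->.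
    by rewrite rmorph0.
  - move/(_ (toR 'X%:P)); rewrite (loc_ker_to_loc id_rho) (loc_ker_to_loc modx_neq0) /=.
    by rewrite map_polyC /= /horner_eval hornerX !polyC_eq0 polyX_eq0 eqxx => /(_ isT).
  - move=> a; have [f [g [g0 ->]]] := loc_frac a.
    by rewrite (loc_kerE modx_neq0) // loc_max_frac // rho_modx => /eqP ->; rewrite horner0.
  - move/(_ (toR 'X)); rewrite loc_max_to_loc (loc_ker_to_loc modx_neq0) /=.
    by rewrite rhoE hornerX horner0 eqxx map_polyX polyX_eq0 => /(_ isT).
move=> n [T [Tp Tst]]; rewrite leqNgt; apply/negP => n3.
have [s01 n10] := Tst 0%N (ltnW (ltnW n3)); have [s12 n21] := Tst 1%N (ltnW n3).
have [s23 n32] := Tst 2%N n3.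
have Tp0 := Tp 0%N (leq0n _); have Tp1 := Tp 1%N (ltnW (ltnW n3)).
have Tp2 := Tp 2%N (ltnW n3); have Tp3 := Tp 3%N n3.
have ex (U V : {pred R}) : ~ {subset U <= V} -> exists a, a \in U /\ a \notin V.
  move=> nsub; apply: contrapT => no; apply: nsub => a aU; apply/negPn/negP => aV.
  by apply: no; exists a.
have [p [p1 p0]] := ex _ _ n10; have [g [g2 g1]] := ex _ _ n21.
have pn0 : p != 0 by apply: contraNneq p0 => ->; have [[]] := Tp0.
(* In a chain of four primes the second is nonzero, so the third already contains the maximal ideal
   and the fourth cannot be larger. *)
have sub := height_two Tp1 Tp2 s12 p1 pn0 g2 g1.
by apply: n32 => a /(proper_sub_max Tp3.1) /sub.
Qed.

Lemma loc_max_generated : exists g : 'I_2 -> R, generates g (loc_max rho).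
Proof.
have rho_rho g : rho g != 0 -> rho g != 0 by [].
have mp : prime_ideal (loc_max rho) := loc_ker_prime rho_rho.
exists (fun i => if i == ord0 then toR 'X%:P else toR 'X) => a; split.
  have [f [g [g0 ->]]] := loc_frac a; rewrite loc_max_frac // => /eqP/rho_eq0 [s [t ->]].
  exists (fun i => if i == ord0 then toR s / toR g else toR t / toR g).
  rewrite !big_ord_recl big_ord0 /= addr0 rmorphD !rmorphM mulrDl.
  by congr (_ + _); rewrite mulrAC mulrC mulrA mulrAC.
case=> d ->; rewrite !big_ord_recl big_ord0 /= addr0.
have inm f : rho f = 0 -> toR f \in loc_max rho.
  by move=> f0; rewrite loc_max_to_loc f0.
have [[_ _ lin] _] := mp; apply: lin; first by apply: inm; rewrite rhoE hornerC hornerX.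
by apply: (primeM mp); apply: inm; rewrite rhoE hornerX horner0.
Qed.

Lemma loc_regular : noetherian A -> regular_local_ring (loc_max rho) 2.
Proof.
move=> An; split; [|exact: loc_local|exact: loc_krull_dim|exact: loc_max_generated].
by apply: noetherian_loc; do 2!apply: noetherian_poly.
Qed.
End KrullDimension.

(** * Transcendental slopes and the growth of the lengths *)

Section Transcendental.
Variable F : realType.

Lemma countable_algebraic : countable [set x : F | algebraicOver (ratr : rat -> F) x].
Proof.
pose roots (p : {poly rat}) := [set x : F | p != 0 /\ root (map_poly ratr p) x].
have -> : [set x : F | algebraicOver (ratr : rat -> F) x] = \bigcup_(p in [set: {poly rat}]) roots p.
  apply/seteqP; split=> x /= [p]; first by move=> p0 px; exists p.
  by move=> _ [p0 px]; exists p.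
apply: bigcup_countable => [|p _]; first exact: countableP.
apply: finite_set_countable; apply: contrapT => infp.
have [p0|p0] := eqVneq p 0.
  apply: infp; suff -> : roots p = set0 by [].
  by apply/seteqP; split=> // x []; rewrite p0 eqxx.
have [B BA Bs] := infinite_set_fset (size p) infp.
have q0 : map_poly (ratr : rat -> F) p != 0 by rewrite map_poly_eq0.
have allB : all (root (map_poly (ratr : rat -> F) p)) (enum_fset B).
  by apply/allP => x xB; have [] := BA x xB.
have := max_poly_roots q0 allB (fset_uniq B).
by rewrite size_map_poly ltnNge Bs.
Qed.

(** Otherwise the interval would be countable, hence of Lebesgue measure 0. *)
Lemma exists_transcendental (a b : F) : a < b -> exists x, a < x < b /\ transcendental x.
Proof.
move=> ab; apply: contrapT => no.
have sub : `]a, b[%classic `<=` [set x : F | algebraicOver (ratr : rat -> F) x].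
  move=> x; rewrite /= in_itv /= => axb; apply: contrapT => tx; apply: no.
  by exists x.
have := countable_lebesgue_measure0 (sub_countable (subset_card_le sub) countable_algebraic).
rewrite lebesgue_measure_itv /= lte_fin ab -EFinB => /eqP.
by rewrite eqe subr_eq0 => /eqP ba; rewrite ba ltxx in ab.
Qed.

Lemma rational_algebraic (x : F) : rational x -> algebraicOver (ratr : rat -> F) x.
Proof. by move=> [q _ <-]; apply: algebraic_id. Qed.

Lemma transcendental_irrational (x : F) : transcendental x -> irrational x.
Proof. by move=> tx /rational_algebraic. Qed.

Lemma transcendental_inv (x : F) : transcendental x -> transcendental x^-1.
Proof. by move=> tx /algebraic_inv; rewrite invrK. Qed.

Lemma transcendental_divn (x : F) n : transcendental x -> transcendental (x / n.+1%:R).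
Proof.
move=> tx xn; apply: tx; rewrite -[x](@divfK _ n.+1%:R) ?pnatr_eq0 //.
apply: algebraic_mul xn _; rewrite -(ratr_nat F n.+1); exact: algebraic_id.
Qed.
End Transcendental.

(** * Counting the values v(b) *)

Section Values.
Local Open Scope nat_scope.
Variable v : nat -> nat.
Hypothesis v0 : 0 < v 0.
Hypothesis vS : forall i, 2 * v i < v i.+1.

Let kv N b := \sum_(i < N) bit b i * v i.

(** Each v_N exceeds the sum of all earlier v_i, so values compare as binary numbers do: the highest
    differing bit decides. *)
Let kv_lt N b : kv N b < v N.
Proof.
elim: N => [|N IH]; first by rewrite /kv big_ord0.
rewrite /kv big_ord_recr /= -/(kv N b); have := vS N.
by case: (bit b N); rewrite ?mul1n ?mul0n; lia.
Qed.

Lemma bit_modn b N i : i < N -> bit (b %% 2 ^ N) i = bit b i.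
Proof.
move=> iN; rewrite /bit {2}(divn_eq b (2 ^ N)) -(subnK (ltnW iN)) expnD mulnA.
rewrite divnMDl ?expn_gt0 // oddD oddM oddX subn_eq0 leqNgt iN /= andbF addFb.
by rewrite -expnD subnK // ltnW.
Qed.

Let kv_modn N b : kv N (b %% 2 ^ N) = kv N b.
Proof. by apply: eq_bigr => i _; rewrite bit_modn. Qed.

Let kv_mono N b b' : b < b' -> b' < 2 ^ N -> kv N b < kv N b'.
Proof.
elim: N b b' => [|N IH] b b' bb' b'N; first by move: bb' b'N; rewrite expn0; lia.
have kvE a : kv N.+1 a = kv N (a %% 2 ^ N) + bit a N * v N.
  by rewrite kv_modn /kv big_ord_recr.
have aE a : a < 2 ^ N.+1 -> a = bit a N * 2 ^ N + a %% 2 ^ N.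
  move=> aN; rewrite {1}(divn_eq a (2 ^ N)); congr (_ * _ + _).
  rewrite /bit; have : a %/ 2 ^ N < 2 by rewrite ltn_divLR ?expn_gt0 // -expnS.
  by case: (a %/ 2 ^ N) => [|[|]].
rewrite !kvE; have := aE _ (ltn_trans bb' b'N); have := aE _ b'N.
have r'N : b' %% 2 ^ N < 2 ^ N by rewrite ltn_mod expn_gt0.
have rN : b %% 2 ^ N < 2 ^ N by rewrite ltn_mod expn_gt0.
have lt := kv_lt N (b %% 2 ^ N).
case: (bit b N); case: (bit b' N); rewrite ?mul1n ?mul0n => E' E.
- by rewrite ltn_add2r IH //; move: E E' bb'; lia.
- by move: E E' bb' r'N; lia.
- by move: lt; lia.
- by rewrite ltn_add2r IH //; move: E E' bb'; lia.
Qed.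

Lemma key_value_mono b b' : b < b' -> key_value v b < key_value v b'.
Proof.
move=> bb'; have b'b : b' < 2 ^ b' by apply: ltn_expl.
by rewrite (key_valueE v (ltn_trans bb' b'b)) (key_valueE v b'b); apply: kv_mono.
Qed.

Lemma key_value_ge b : b <= key_value v b.
Proof.
elim: b => // b IH; apply: leq_ltn_trans IH _; exact: key_value_mono.
Qed.

Lemma value_count_ex n : exists b, n < key_value v b.
Proof. by exists n.+1; apply: key_value_ge. Qed.

(* Since [key_value v] is increasing, this counts the [b] with [key_value v b <= n]. *)
Definition value_count n := ex_minn (value_count_ex n).

Lemma value_countP b n : (b < value_count n) = (key_value v b <= n).
Proof.
rewrite /value_count; case: ex_minnP => m nm mmin; apply/idP/idP => [bm|bn].
  by rewrite leqNgt; apply/negP => /mmin; rewrite leqNgt bm.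
rewrite ltnNge; apply/negP; rewrite leq_eqVlt => /orP [/eqP mb|/key_value_mono].
  by move: nm; rewrite mb ltnNge bn.
by move: nm bn; lia.
Qed.

Lemma key_value0 : key_value v 0 = 0. Proof. by rewrite /key_value big_ord0. Qed.

Lemma value_count_gt0 n : 0 < value_count n.
Proof. by rewrite value_countP key_value0. Qed.

Lemma value_count_key b : value_count (key_value v b) = b.+1.
Proof.
apply/eqP; rewrite eqn_leq value_countP leqnn andbT leqNgt value_countP -ltnNge.
exact: key_value_mono.
Qed.

Lemma value_count_le n n' : n <= n' -> value_count n <= value_count n'.
Proof.
move=> nn'; rewrite -(prednK (value_count_gt0 n)) value_countP.
by apply: leq_trans nn'; rewrite -value_countP prednK ?value_count_gt0.
Qed.
End Values.

Section BitCount.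
Local Open Scope nat_scope.
Definition bit_count b := \sum_(i < b) bit b i.

Lemma sum_bit_id b : \sum_(i < b) bit b i * 2 ^ i = b.
Proof. by rewrite sum_bit modn_small // ltn_expl. Qed.

(** At most k digits 1 lie below position k, and each other one contributes at least 2^k to [b].
    With k free this gives o(b) without logarithms. *)
Lemma bit_count_le k b : bit_count b * 2 ^ k <= k * 2 ^ k + b.
Proof.
rewrite /bit_count -[X in _ <= _ + X](sum_bit_id b) big_distrl /=.
have H n : \sum_(i < n) (i < k) <= k.
  suff -> : \sum_(i < n) (i < k) = minn n k by rewrite geq_minr.
  elim: n => [|n IH]; first by rewrite big_ord0 min0n.
  by rewrite big_ord_recr /= IH; case: (ltnP n k); lia.
apply: leq_trans (leq_add (leq_mul (H b) (leqnn _)) (leqnn _)).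
rewrite big_distrl /= -big_split /=; apply: leq_sum => i _.
case: (ltnP i k) => [ik|ki]; first by case: (bit b i); rewrite ?mul1n ?mul0n; lia.
by rewrite mul0n add0n leq_mul2l leq_pexp2l // orbT.
Qed.

Lemma bit_count_ones N : bit_count (2 ^ N).-1 = N.
Proof.
have NN : (2 ^ N).-1 < 2 ^ N by rewrite prednK ?expn_gt0.
rewrite /bit_count (@big_bit _ 0 addn (fun i => bit (2 ^ N).-1 i : nat) _ _ NN).
  rewrite (eq_bigr (fun=> 1)) ?sum_nat_const ?card_ord ?muln1 // => i _.
  suff -> : bit (2 ^ N).-1 i by [].
  have iN := ltn_ord i; rewrite /bit.
  have -> : (2 ^ N).-1 = (2 ^ (N - i)).-1 * 2 ^ i + (2 ^ i).-1.
    rewrite -[in LHS](subnK (ltnW iN)) expnD.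
    have := expn_gt0 2 i; have := expn_gt0 2 (N - i).
    by case: (2 ^ i) => // a; case: (2 ^ (N - i)) => // b _ _; rewrite mulSn /=; lia.
  rewrite divnMDl ?expn_gt0 // divn_small ?prednK ?expn_gt0 // addn0.
  have := oddX 2 (N - i); rewrite subn_eq0 leqNgt iN /=.
  have := expn_gt0 2 (N - i).
  by case: (2 ^ (N - i)) => //= a _ /negbFE.
by move=> i ->.
Qed.
End BitCount.

Section Limits.
Variable F : realType.

Lemma exists_pow2_inv_lt (e : F) : 0 < e -> exists k, (2 ^+ k)^-1 < e.
Proof.
move=> e0; exists (Num.truncn e^-1); rewrite -[X in _ < X]invrK ltf_pV2 ?posrE ?invr_gt0 ?exprn_gt0 //.
apply: lt_le_trans (truncnS_gt _) _; by rewrite -natrX ler_nat ltn_expl.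
Qed.

Lemma cvg_of_bound (w : nat -> F) (L : F) :
  (forall k, exists K : F, forall n, (0 < n)%N -> `|w n - L| <= K / n%:R + (2 ^+ k)^-1) ->
  w n @[n --> \oo] --> L.
Proof.
move=> H; apply/cvgrPdist_le => e e0.
have [k ke] := exists_pow2_inv_lt (divr_gt0 e0 (ltr0Sn F 1)).
have [K KP] := H k.
exists (Num.truncn (2 * K / e)).+1 => // n /= nK.
have n0 : (0 < n)%N by apply: leq_trans nK.
rewrite distrC; apply: le_trans (KP n n0) _.
have nR : 0 < n%:R :> F by rewrite ltr0n.
have : 2 * K / e < n%:R.
  by apply: lt_le_trans (truncnS_gt _) _; rewrite ler_nat.
rewrite ltr_pdivrMr // => Kn.
have : K / n%:R < e / 2 by rewrite ltr_pdivrMr //; move: Kn; lra.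
by move: ke; lra.
Qed.

(** The hypothesis is convergence to 0 along the positive integers, in the form that [bit_count_le]
    supplies. *)
Lemma poly_tends0 (H : {poly F}) :
  (forall k, exists K : F, forall m, (0 < m)%N -> `|H.[m%:R]| <= K / m%:R + (2 ^+ k)^-1) -> H = 0.
Proof.
have small (x : F) : (forall k, exists K : F, forall m, (0 < m)%N ->
    `|x| <= K / m%:R + (2 ^+ k)^-1) -> x = 0.
  move=> xH; apply/eqP; rewrite -normr_le0 leNgt; apply/negP => x0.
  have [k kx] := exists_pow2_inv_lt (divr_gt0 x0 (ltr0Sn F 1)).
  have [K KP] := xH k; pose m := (Num.truncn (2 * K / `|x|)).+1.
  have mR : 0 < m%:R :> F by rewrite ltr0n.
  have : 2 * K / `|x| < m%:R by apply: truncnS_gt.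
  rewrite ltr_pdivrMr // => Km.
  have : K / m%:R < `|x| / 2 by rewrite ltr_pdivrMr //; move: Km; lra.
  by have := KP m isT; move: kx; lra.
elim/poly_ind: H => // H a IH bnd.
have H0 : H = 0.
  (* Boundedness of H(m) m + a is enough here: it makes H(m) of size O(1/m), which serves for every
     [k]. *)
  apply: IH => k; have [K KP] := bnd 0%N.
  exists (`|K| + 1 + `|a|) => m m0; have mR : 1 <= m%:R :> F by rewrite ler1n.
  have mR0 : 0 < m%:R :> F by rewrite ltr0n.
  have := KP m m0; rewrite hornerMXaddC expr0 invr1 => Hm.
  have {}Hm : `|H.[m%:R] * m%:R| <= `|K| + 1 + `|a|.
    have -> : H.[m%:R] * m%:R = (H.[m%:R] * m%:R + a) - a by rewrite addrK.
    apply: le_trans (ler_normB _ _) _; rewrite lerD2r (le_trans Hm) // lerD2r.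
    by rewrite ler_pdivrMr // (le_trans (ler_norm K)) // ler_peMr.
  have p0 : 0 <= (2 ^+ k)^-1 :> F by rewrite invr_ge0 exprn_ge0.
  move: Hm; rewrite normrM (gtr0_norm mR0) -ler_pdivlMr // => Hm.
  by apply: le_trans Hm _; rewrite lerDl.
rewrite H0 mul0r add0r; rewrite H0 in bnd; suff -> : a = 0 by [].
apply: small => k; have [K KP] := bnd k; exists K => m m0.
by have := KP m m0; rewrite hornerMXaddC horner0 mul0r add0r.
Qed.
End Limits.

Section QuasiPolynomial.
Variable F : realType.

(** For [p] a common period, the product of the periods, the coefficients are constant along each
    class modulo [p]. *)
Lemma quasi_polynomial_progression (f : nat -> F) : quasi_polynomial_plus_bounded f ->
  exists2 p, (0 < p)%N & forall r, exists (G : {poly F}) (C : F) m0,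
    forall m, (m0 <= m)%N -> `|f (p * m + r)%N - G.[m%:R]| <= C.
Proof.
move=> [Q [sigma [[d [a [aper QE]]] [C CP] [n0 fE]]]].
have [p p0 pP] : exists2 p, (0 < p)%N & forall i, (i <= d)%N -> periodic (a i) p%:Z.
  elim: (d) aper => [|e IH] aper.
    have [[q|q] // q0 qP] := aper 0%N (leqnn _).
    by exists q => // i; rewrite leqn0 => /eqP ->.
  have [i ie|p p0 pP] := IH; first by apply: aper; apply: leqW.
  have [[q|q] // q0 qP] := aper e.+1 (leqnn _).
  exists (p * q)%N; first by rewrite muln_gt0 p0; move: q0; rewrite ltz_nat.
  move=> i; rewrite leq_eqVlt => /orP [/eqP ->|ie] u.
    by have := periodicn qP p u; rewrite -mulr_natr natz -PoszM mulnC.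
  by have := periodicn (pP i ie) q u; rewrite -mulr_natr natz -PoszM.
exists p => // r.
exists (\sum_(i < d.+1) (a i r%:Z)%:P * (p%:R *: 'X + r%:R%:P) ^+ i), C, `|n0|%N => m m0.
rewrite fE; last first.
  apply: le_trans (lez_abs _) _; rewrite lez_nat (leq_trans m0) //.
  by rewrite (leq_trans (leq_pmull m p0)) // leq_addr.
suff -> : Q (p * m + r)%N = (\sum_(i < d.+1) (a i r%:Z)%:P * (p%:R *: 'X + r%:R%:P) ^+ i).[m%:R].
  by rewrite addrC addKr.
rewrite QE horner_sum; apply: eq_bigr => i _.
rewrite hornerM hornerC horner_exp hornerD hornerZ hornerX hornerC.
rewrite -natrM -natrD; congr (_ * _).
have := periodicn (pP i (ltn_ord i)) m r%:Z; rewrite -mulr_natr natz => <-; congr (a i _).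
by rewrite PoszD PoszM addrC.
Qed.
End QuasiPolynomial.

(** * The count of values: slope and unbounded deviation *)

Section Asymptotics.
Variables (F : realType) (c : F).
Hypothesis c2 : 2 < c.

(** With t = floor(c 2^i), the predecessor turns floor(2 c 2^i) >= 2 t into the strict 2 v_i <
    v_(i+1), and it makes each digit 1 of b cost at least 1 in c b - v(b). The bound c > 2 keeps v_0
    positive. *)
Definition slope_value (i : nat) : nat := (Num.truncn (c * 2 ^+ i)).-1.
Local Notation v := slope_value.

Let c0 : 0 < c. Proof. by apply: lt_trans c2. Qed.

Let z0 i : 0 <= c * 2 ^+ i. Proof. by rewrite mulr_ge0 ?exprn_ge0 // ltW. Qed.

Let trunc_ge2 i : (2 <= Num.truncn (c * 2 ^+ i))%N.
Proof.
rewrite truncn_ge_nat //.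
have p1 : 1 <= 2 ^+ i :> F by rewrite exprn_ege1 // ler1n.
by apply: le_trans (ltW c2) _; rewrite ler_peMr // ltW.
Qed.

Lemma slope_value_bounds i :
  c * 2 ^+ i - 2 <= (v i)%:R <= c * 2 ^+ i - 1.
Proof.
have /andP [lo hi] := truncn_itv (z0 i).
have := trunc_ge2 i; rewrite /v; case: (Num.truncn _) lo hi => // t lo hi _ /=.
by move: lo hi; rewrite -!natr1 => lo hi; apply/andP; split; lra.
Qed.

Lemma slope_value0 : (0 < v 0)%N.
Proof. by rewrite /v; have := trunc_ge2 0; case: (Num.truncn _) => [|[|]]. Qed.

Lemma slope_valueS i : (2 * v i < v i.+1)%N.
Proof.
have : (2 * Num.truncn (c * 2 ^+ i) <= Num.truncn (c * 2 ^+ i.+1))%N.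
  rewrite truncn_ge_nat // natrM exprS mulrCA ler_pM2l //.
  by have /andP [] := truncn_itv (z0 i).
by have := trunc_ge2 i; rewrite /v; lia.
Qed.

Local Notation vQ := (key_value v).

Lemma key_value_bounds b :
  c * b%:R - 2 * (bit_count b)%:R <= (vQ b)%:R <= c * b%:R - (bit_count b)%:R.
Proof.
have -> : b%:R = \sum_(i < b) (bit b i)%:R * 2 ^+ i :> F.
  rewrite -{1}(sum_bit_id b) natr_sum.
  by apply: eq_bigr => i _; rewrite natrM natrX.
have -> : (vQ b)%:R = \sum_(i < b) (bit b i)%:R * (v i)%:R :> F.
  by rewrite natr_sum; apply: eq_bigr => i _; rewrite natrM.
have -> : (bit_count b)%:R = \sum_(i < b) (bit b i)%:R :> F by rewrite natr_sum.
rewrite !mulr_sumr -!sumrB; apply/andP; split; apply: ler_sum => i _;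
  have /andP [] := slope_value_bounds i; case: (bit b i); rewrite /= ?mulr1n ?mulr0n ?mul1r ?mul0r ?mulr0; lra.
Qed.

Definition slope_count := value_count slope_value0 slope_valueS.
Local Notation cn := slope_count.

Lemma slope_count_lower n : n%:R / c <= (cn n)%:R.
Proof.
have : (n < vQ (cn n))%N by rewrite ltnNge -(value_countP slope_value0 slope_valueS) -/cn ltnn.
rewrite -(ltr_nat F) => H; rewrite ler_pdivrMr // mulrC.
have /andP [_ ] := key_value_bounds (cn n).
have : 0 <= (bit_count (cn n))%:R :> F by rewrite ler0n.
by move: H; lra.
Qed.

(** For [b] the largest index counted, c b <= v(b) + 2 [bit_count b], with v(b) <= n and b <= n in
    [bit_count_le]; the factor 2 is absorbed by c > 2. *)
Lemma slope_count_upper k n : (cn n)%:R - n%:R / c <= 1 + k%:R + n%:R / 2 ^+ k.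
Proof.
have [b bE] : exists b, cn n = b.+1 by exists (cn n).-1; rewrite prednK ?value_count_gt0.
have bn : (vQ b <= n)%N by rewrite -(value_countP slope_value0 slope_valueS) -/cn bE.
have b_n : (b <= n)%N.
  exact: leq_trans (key_value_ge slope_value0 slope_valueS b) bn.
rewrite bE -natr1; have /andP [+ _] := key_value_bounds b.
have p0 : 0 < 2 ^+ k :> F by rewrite exprn_gt0.
have : (bit_count b)%:R <= k%:R + n%:R / 2 ^+ k :> F.
  rewrite -(ler_pM2r p0) mulrDl divfK ?gt_eqF // -natrX -!natrM -natrD ler_nat.
  by apply: leq_trans (bit_count_le k b) _; rewrite leq_add2l.
have : (vQ b)%:R <= n%:R :> F by rewrite ler_nat.
set s := (bit_count b)%:R; set w := (vQ b)%:R; set t := n%:R / 2 ^+ k.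
move=> wn st H; have cb : c * b%:R <= n%:R + 2 * (k%:R + t) by move: H wn st; lra.
have kt0 : 0 <= k%:R + t by rewrite addr_ge0 ?divr_ge0 ?ler0n // ltW.
have : b%:R <= n%:R / c + (k%:R + t).
  rewrite -(ler_pM2l c0) mulrDr mulrCA divff ?gt_eqF // mulr1 (le_trans cb) // lerD2l.
  by rewrite ler_wpM2r // ltW.
by lra.
Qed.

Lemma slope_count_dist k n : `|(cn n)%:R - n%:R / c| <= 1 + k%:R + n%:R / 2 ^+ k.
Proof.
by rewrite ger0_norm ?subr_ge0 ?slope_count_lower ?slope_count_upper.
Qed.

Lemma slope_count_cvg : ((cn n)%:R / n%:R : F) @[n --> \oo] --> c^-1.
Proof.
apply: cvg_of_bound => k; exists (1 + k%:R) => n n0.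
have nR : 0 < n%:R :> F by rewrite ltr0n.
have -> : (cn n)%:R / n%:R - c^-1 = ((cn n)%:R - n%:R / c) / n%:R.
  by rewrite mulrBl mulrAC divff ?gt_eqF // mul1r.
rewrite normrM normfV (gtr0_norm nR) ler_pdivrMr // mulrDl divfK ?gt_eqF // [_^-1 * _]mulrC.
exact: slope_count_dist.
Qed.

Lemma slope_count_sum_cvg :
  ((\sum_(m < n) cn m)%:R / n%:R ^+ 2 : F) @[n --> \oo] --> c^-1 / 2.
Proof.
(* The summand 1 + k comes from [slope_count_dist], and c^-1 / 2 from the linear term of the sum of
   m < n, equal to (n^2 - n)/2. *)
apply: cvg_of_bound => k; exists (1 + k%:R + c^-1 / 2) => n n0.
have nR : 0 < n%:R :> F by rewrite ltr0n.
have sumE : \sum_(m < n) (m%:R / c) = (n%:R ^+ 2 - n%:R) / 2 / c :> F.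
  rewrite -mulr_suml; congr (_ / c); elim: (n) => [|m IH]; first by rewrite big_ord0 expr0n /= subrr mul0r.
  by rewrite big_ord_recr /= IH -natr1; field.
have dist : `|(\sum_(m < n) cn m)%:R - \sum_(m < n) (m%:R / c)| <= n%:R * (1 + k%:R + n%:R / 2 ^+ k).
  rewrite natr_sum -sumrB; apply: le_trans (ler_norm_sum _ _ _) _.
  rewrite mulr_natl -[X in _ <= _ *+ X]card_ord -sumr_const; apply: ler_sum => i _.
  apply: le_trans (slope_count_dist k i) _; rewrite lerD2l ler_pM2r ?invr_gt0 ?exprn_gt0 //.
  by rewrite ler_nat ltnW.
rewrite -(ler_pM2r (exprn_gt0 2 nR)) -[X in _ * X <= _](gtr0_norm (exprn_gt0 2 nR)) -normrM.
have -> : ((\sum_(m < n) cn m)%:R / n%:R ^+ 2 - c^-1 / 2) * n%:R ^+ 2 =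
  ((\sum_(m < n) cn m)%:R - \sum_(m < n) (m%:R / c)) - n%:R * (c^-1 / 2).
  rewrite sumE; field; rewrite ?gt_eqF //.
apply: le_trans (ler_normB _ _) _; rewrite [X in _ + X]ger0_norm; last first.
  by rewrite mulr_ge0 ?ltW ?divr_gt0 ?invr_gt0.
apply: le_trans (lerD dist (lexx _)) _.
have -> : ((1 + k%:R + c^-1 / 2) / n%:R + (2 ^+ k)^-1) * n%:R ^+ 2 =
   n%:R * (1 + k%:R + n%:R / 2 ^+ k) + n%:R * (c^-1 / 2); last exact: lexx.
by field; rewrite ?gt_eqF ?exprn_gt0.
Qed.

Lemma slope_count_unbounded (C : F) n0 : exists2 n, (n0 <= n)%N & C < (cn n)%:R - n%:R / c.
Proof.
(* All N digits of this [b] are 1, so the deviation at n = v(b) is at least 1 + N/c. The two bounds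
   on N give n >= n0 and N/c > C. *)
pose N := (maxn n0.+1 (Num.truncn (C * c)).+1); pose b := (2 ^ N).-1.
have bb : b.+1 = (2 ^ N)%N by rewrite prednK ?expn_gt0.
exists (vQ b).
  apply: leq_trans (key_value_ge slope_value0 slope_valueS b).
  rewrite -ltnS bb; apply: ltn_trans (ltn_expl N (isT : 1 < 2)%N).
  by rewrite leq_max ltnSn.
rewrite /slope_count value_count_key -natr1; have /andP [_] := key_value_bounds b.
rewrite /b bit_count_ones -/b => H.
have CN : C * c < N%:R.
  by apply: lt_le_trans (truncnS_gt _) _; rewrite ler_nat leq_maxr.
have : (vQ b)%:R / c <= b%:R - N%:R / c.
  by rewrite ler_pdivrMr // mulrBl divfK ?gt_eqF // mulrC.
have : C < N%:R / c by rewrite ltr_pdivlMr.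
by lra.
Qed.

Lemma slope_count_not_polynomial p (G : {poly F}) (C : F) m0 : (0 < p)%N ->
  ~ (forall m, (m0 <= m)%N -> `|(cn (p * m))%:R - G.[m%:R]| <= C).
Proof.
move=> p0 H; pose P : {poly F} := G - (p%:R / c) *: 'X.
have PE m : P.[m%:R] = G.[m%:R] - (p * m)%:R / c.
  by rewrite hornerD hornerN hornerZ hornerX natrM mulrAC.
(* [P] is sublinear at the integers, hence constant *)
have [P' [a PP']] : exists (P' : {poly F}) a, P = P' * 'X + a%:P.
  by elim/poly_ind: (P) => [|q a _]; [exists 0, 0; rewrite mul0r add0r|exists q, a].
have P'0 : P' = 0.
  apply: poly_tends0 => k.
  pose M := \sum_(m < m0) `|P'.[m%:R]| * m%:R.
  (* [M] takes care of the finitely many m < m0. Using [slope_count_dist] at k + p instead of k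
     absorbs the factor p of the argument, since p <= 2^p. *)
  exists (M + C + `|a| + 1 + (k + p)%:R) => m m_gt0.
  have mR : 0 < m%:R :> F by rewrite ltr0n.
  have pow0 (i : nat) : 0 < 2 ^+ i :> F by rewrite exprn_gt0.
  have M_ge0 (i : 'I_m0) : 0 <= `|P'.[i%:R]| * i%:R by rewrite mulr_ge0.
  have C0 : 0 <= C by apply: le_trans (H m0 (leqnn _)).
  rewrite -(ler_pM2r mR) mulrDl divfK ?gt_eqF //.
  have [mm0|mm0] := ltnP m m0.
    have : `|P'.[m%:R]| * m%:R <= M.
      by rewrite /M (bigD1 (Ordinal mm0)) //= lerDl sumr_ge0.
    have : 0 <= (2 ^+ k)^-1 * m%:R :> F by rewrite mulr_ge0 ?invr_ge0 ?(ltW (pow0 k)) ?(ltW mR).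
    have := normr_ge0 a; have : 0 <= (k + p)%:R :> F by rewrite ler0n.
    by move: C0; lra.
  have M0 : 0 <= M by apply: sumr_ge0.
  have E : P'.[m%:R] * m%:R = (G.[m%:R] - (cn (p * m))%:R) + ((cn (p * m))%:R - (p * m)%:R / c) - a.
    by have := PE m; rewrite PP' hornerMXaddC => E; rewrite -[LHS](addrK a) E; ring.
  rewrite -[X in _ * X <= _](gtr0_norm mR) -normrM E.
  apply: le_trans (ler_normB _ _) _.
  have n1 := ler_normD (G.[m%:R] - (cn (p * m))%:R) ((cn (p * m))%:R - (p * m)%:R / c).
  have n2 := H m mm0; rewrite distrC in n2.
  have n3 := slope_count_dist (k + p) (p * m).
  have n4 : (p * m)%:R / 2 ^+ (k + p) <= (2 ^+ k)^-1 * m%:R :> F.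
    rewrite exprD natrM ler_pdivrMr ?mulr_gt0 //.
    have -> : (2 ^+ k)^-1 * m%:R * (2 ^+ k * 2 ^+ p) = 2 ^+ p * m%:R :> F.
      by rewrite mulrACA mulVf ?gt_eqF // mul1r mulrC.
    by rewrite ler_pM2r // -natrX ler_nat ltnW // ltn_expl.
  by move: n1 n2 n3 n4 M0; lra.
have dist m : (m0 <= m)%N -> `|(cn (p * m))%:R - (p * m)%:R / c| <= C + `|a|.
  move=> mm0; have := H m mm0; have := PE m; rewrite PP' P'0 mul0r add0r hornerC => aE.
  have -> : (cn (p * m))%:R - (p * m)%:R / c = ((cn (p * m))%:R - G.[m%:R]) + a by rewrite aE; ring.
  by move=> h; apply: le_trans (ler_normD _ _) _; rewrite lerD2r.
have [n n_ge] := slope_count_unbounded (C + `|a| + p%:R / c) (p * m0)%N.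
apply/negP; rewrite -leNgt.
(* The next multiple of p above [n]: the count is monotone and n/c grows by at most p/c, so a bound
   along multiples of p gives one everywhere. *)
pose m := (n %/ p).+1.
have nm : (n <= p * m)%N by rewrite mulnC ltnW // ltn_ceil.
have mn : (p * m <= n + p)%N by rewrite mulnS addnC leq_add2r mulnC leq_divM.
have mm0 : (m0 <= m)%N.
  by apply: leqW; rewrite leq_divRL // mulnC.
have := dist m mm0; have cc := value_count_le slope_value0 slope_valueS nm.
rewrite -/cn -(ler_nat F) in cc; move/(le_trans (ler_norm _)) => D.
have : (p * m)%:R / c <= n%:R / c + p%:R / c.
  by rewrite -mulrDl -natrD ler_pM2r ?invr_gt0 // ler_nat.
by move: D cc; lra.
Qed.
End Asymptotics.

Section NotQuasiPolynomial.
Variables (F : realType) (c : F).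
Hypothesis c2 : 2 < c.
Local Notation cn := (slope_count c2).

Lemma slope_count_not_quasi_polynomial :
  ~ quasi_polynomial_plus_bounded (fun n => (cn n)%:R : F).
Proof.
move=> /quasi_polynomial_progression [p p0 /(_ 0%N) [G [C [m0 H]]]].
apply: (@slope_count_not_polynomial F c c2 p G C m0 p0) => m mm0.
by have := H m mm0; rewrite addn0.
Qed.

(** Subtracting the approximations along p m and p m + 1 would approximate the count at p m by a
    polynomial. *)
Lemma slope_count_sum_not_quasi_polynomial :
  ~ quasi_polynomial_plus_bounded (fun n => (\sum_(i < n) cn i)%:R : F).
Proof.
move=> /quasi_polynomial_progression [p p0 H].
have [G0 [C0 [m0 H0]]] := H 0%N; have [G1 [C1 [m1 H1]]] := H 1%N.
apply: (@slope_count_not_polynomial F c c2 p (G1 - G0) (C1 + C0) (maxn m0 m1) p0) => m.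
rewrite geq_max => /andP [/H0 h0 /H1 h1]; move: h0 h1.
rewrite addn0 addn1 big_ord_recr /= natrD hornerD hornerN => h0 h1.
set s := (\sum_(i < _) _)%:R in h0 h1.
have -> : (cn (p * m))%:R - (G1.[m%:R] - G0.[m%:R]) =
  (s + (cn (p * m))%:R - G1.[m%:R]) - (s - G0.[m%:R]) by ring.
by apply: le_trans (ler_normB _ _) _; apply: lerD.
Qed.
End NotQuasiPolynomial.

Theorem corollary1p5 (F : realType) :
  exists (R : idomainType) (mR : {pred R})
         (nu : discrete_valuation {fraction R}) (dom : dominates nu mR)
         (lq li : nat -> nat) (Lq Li : F),
    regular_local_ring mR 2 /\
    (forall n : nat, has_length (quotient_module (valuation_ideal dom n)) (lq n)) /\
    (forall n : nat, has_length
       (subquotient (valuation_ideal dom n) (valuation_ideal dom n.+1)) (li n)) /\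
    ~ quasi_polynomial_plus_bounded (fun n => (lq n)%:R : F) /\
    ~ quasi_polynomial_plus_bounded (fun n => (li n)%:R : F) /\
    ((li n)%:R / n%:R : F) @[n --> \oo] --> Li /\
    ((lq n)%:R / n%:R ^+ 2 : F) @[n --> \oo] --> Lq /\
    (0 < Li /\ irrational Li /\ transcendental Li) /\
    (0 < Lq /\ irrational Lq /\ transcendental Lq).
Proof.
have lt23 : 2 < 3 :> F by lra.
have [c [/andP [c2 _] tc]] := exists_transcendental lt23.
pose v := slope_value c; pose v0 := slope_value0 c2; pose vS := slope_valueS c2.
pose cn := slope_count c2.
have cP b n : (b < cn n)%N = (key_value v b <= n)%N := value_countP v0 vS b n.
have [nu [dom [lenq leni]]] := loc_valuation_lengths (@sord_is_order rat v vS)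
  (@sord_origin rat v v0 vS) (polyXC_neq0 rat) (@sordX rat v)
  (@gen_in rat v vS cn cP) (@gen_span rat v vS cn cP) (@gen_indep rat v v0 vS cn cP).
have tLi := transcendental_inv tc; have tLq := @transcendental_divn F c^-1 1 tLi.
have Li0 : 0 < c^-1 by rewrite invr_gt0; lra.
have Lq0 : 0 < c^-1 / 2 by rewrite divr_gt0.
exists (loc (origin rat)), (loc_max (origin rat)), nu, dom.
exists (fun n => \sum_(i < n) cn i)%N, cn, (c^-1 / 2), c^-1.
split; first by apply: loc_regular (@originE rat) _; apply: noetherian_poly; apply: noetherian_field.
split; first exact: lenq.
split; first exact: leni.
split; first exact: slope_count_sum_not_quasi_polynomial.
split; first exact: slope_count_not_quasi_polynomial.
split; first exact: slope_count_cvg.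
split; first exact: slope_count_sum_cvg.
by split; do 2?split=> //; apply: transcendental_irrational.
Qed.
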